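(* Let $\mathbb{F}$ be a field of characteristic zero, $q\in\mathbb{F}$ nonzero and not a root of unity, and let $T(n,k)$ be a bivariate $q$-hypergeometric term (with the standing convention below) that has a $q$-normal representation $(r,s,u,v)$ with respect to $K$ such that $v$ is $\varepsilon_y$-free. Then $T$ has a $qZ$-pair if and only if $v$ is a $q$-proper polynomial.
   Context: A function $T:\mathbb{N}^2\to\mathbb{F}$ is a bivariate $q$-hypergeometric term if there exist $R_1,R_2\in\mathbb{F}(x,y)$ with $T(n+1,k)=R_1(q^n,q^k)T(n,k)$ and $T(n,k+1)=R_2(q^n,q^k)T(n,k)$; standing convention: these hold for all $n,k\ge 0$ and $R_1(q^n,q^k),R_2(q^n,q^k)$ are defined and nonzero for all $n,k\ge0$. Let $N,K$ be the shift operators $NT(n,k)=T(n+1,k)$, $KT(n,k)=T(n,k+1)$. A $q$-normal representation of $T$ with respect to $K$ is a tuple of polynomials $r,s,u,v\in\mathbb{F}[x,y]$ with $R_2=\frac{r}{s}\cdot\frac{u(x,qy)/v(x,qy)}{u(x,y)/v(x,y)}$ such that, viewed as polynomials in $y$ over $\mathbb{F}(x)$, $u,v$ are coprime and not divisible by $y$, and $r(x,y)$, $s(x,q^hy)$ are coprime for every $h\in\mathbb{Z}$. $v$ is $\varepsilon_y$-free if for every nonzero integer $m$, $v(x,y)$ and $v(x,q^my)$ have no common irreducible factor of positive degree in $y$ other than $y$. A nonzero $f\in\mathbb{F}[x,y]$ is $q$-proper if each irreducible factor $p$ of $f$ satisfies $p(x,y)\mid p(q^ax,q^by)$ for some integers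 $a,b$ not both zero. A $qZ$-pair for $T$ is a pair $(L,G)$ where $L=\sum_{i=0}^{I}a_i(q^n)N^i$ with $a_i\in\mathbb{F}[x]$ not all zero, and $G$ is a bivariate $q$-hypergeometric term, such that $LT(n,k)=G(n,k+1)-G(n,k)$ for all $n,k\ge 0$.
   Formalization: T is assumed not identically zero, and the term G in a qZ-pair need not satisfy the standing convention: its two recurrences have nonzero rational R1, R2 and hold for all n,k≥0 with denominators cleared, so G may vanish and R1, R2 may have zeros or poles on the grid. *)

(* Defs.v *)
From HB Require Import structures.
From mathcomp Require Import all_boot all_order all_algebra.

Set Implicit Arguments.
Unset Strict Implicit.
Unset Printing Implicit Defensive.

Import GRing.Theory.
Local Open Scope ring_scope.

(* F[x, y] is {poly {poly F}}: y is the outer variable 'X and the            *)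
(* coefficients are polynomials in x. F(x, y) is its field of fractions.     *)
Notation bipoly F := {poly {poly F}}.
Notation birat F := {fraction {poly {poly F}}}.

Section Bivariate.
Variable F : fieldType.
Implicit Types (p d f u v : bipoly F) (R : birat F) (a b c s t q : F).

Definition eval2 p a b : F := p.[b%:P].[a].

(* p(q^i x, q^j y), for i, j in Z *)
Definition qscale q (i j : int) p : bipoly F :=
  map_poly (comp_poly ((q ^ i) *: 'X)) p \Po ((q ^ j)%:P *: 'X).

(* Divisibility in the ring F[x, y]. The library's %| on {poly {poly F}} is  *)
(* pseudo-divisibility, i.e. divisibility in F(x)[y].                        *)
Definition dvd2 p f : Prop := exists g : bipoly F, f = g * p.

(* Likewise, the library's irreducible_poly is not ring irreducibility here. *)
Definition irreducible2 p : Prop :=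
  [/\ p != 0, p \isn't a GRing.unit &
      forall f g : bipoly F, p = f * g ->
        f \is a GRing.unit \/ g \is a GRing.unit].

Definition over_Fx p : {poly {fraction {poly F}}} :=
  map_poly (fun c : {poly F} => tofrac c) p.

Definition is_frac R p d : Prop := d != 0 /\ R = tofrac p / tofrac d.

(* R is defined at (a, b), with value c *)
Definition rat_value R a b c : Prop :=
  exists p d, [/\ is_frac R p d, eval2 d a b != 0 & c = eval2 p a b / eval2 d a b].

(* t = R(a, b) s with denominators cleared, hence meaningful also at a pole  *)
(* of R. It is enough to require it for R in lowest terms.                   *)
Definition cleared_rel R a b s t : Prop :=
  forall p d, is_frac R p d -> eval2 d a b * t = eval2 p a b * s.

Lemma rat_value_cleared R a b c s :
  rat_value R a b c -> cleared_rel R a b s (c * s).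
Proof.
move=> [p0 [d0 [[d0N0 ->] d0ab ->]]] p d [dN0 /eqP].
rewrite GRing.eqr_div ?tofrac_eq0 // -!tofracM tofrac_eq => /eqP e.
have {e} : eval2 (p0 * d) a b = eval2 (p * d0) a b by rewrite e.
rewrite /eval2 !hornerM -!/(eval2 _ _ _) => e.
by rewrite mulrA; congr (_ * _); rewrite mulrCA mulrA e mulfK.
Qed.

Implicit Types T G : nat -> nat -> F.

(* A bivariate q-hypergeometric term with certificates R1 and R2 under the   *)
(* standing convention.                                                      *)
Definition qhyper_conv q T (R1 R2 : birat F) : Prop :=
  forall n k,
    (exists c, [/\ rat_value R1 (q ^+ n) (q ^+ k) c, c != 0
                 & T n.+1 k = c * T n k]) /\
    (exists c, [/\ rat_value R2 (q ^+ n) (q ^+ k) c, c != 0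
                 & T n k.+1 = c * T n k]).

(* A bivariate q-hypergeometric term without the convention that R1 and R2   *)
(* have neither poles nor zeros on the grid: the relations hold for all      *)
(* n, k >= 0 with denominators cleared. This is the notion needed for G in a *)
(* qZ-pair: G is a rational multiple of T and may vanish at some points,     *)
(* e.g. T(n, k) = q^k [n+k, k]_q = G(n, k+1) - G(n, k) with                  *)
(* G(n, k) = [n+k, k-1]_q and G(n, 0) = 0.                                   *)
Definition qhyper q G : Prop :=
  exists R1 R2 : birat F,
    [/\ R1 != 0, R2 != 0 &
      forall n k,
        cleared_rel R1 (q ^+ n) (q ^+ k) (G n k) (G n.+1 k) /\
        cleared_rel R2 (q ^+ n) (q ^+ k) (G n k) (G n k.+1)].

Definition q_normal_rep q (R2 : birat F) (r s u v : bipoly F) : Prop :=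
  [/\ s != 0,
      R2 = tofrac r / tofrac s *
           ((tofrac (qscale q 0 1 u) / tofrac (qscale q 0 1 v)) /
            (tofrac u / tofrac v)),
      coprimep (over_Fx u) (over_Fx v),
      ~~ ('X %| over_Fx u) /\ ~~ ('X %| over_Fx v) &
      forall h : int, coprimep (over_Fx r) (over_Fx (qscale q 0 h s))].

Definition eps_free q v : Prop :=
  forall m : int, m != 0 -> forall p : bipoly F,
    irreducible2 p -> (1 < size p)%N ->
    dvd2 p v -> dvd2 p (qscale q 0 m v) ->
    exists2 c : bipoly F, c \is a GRing.unit & p = c * 'X.

Definition q_proper q f : Prop :=
  f != 0 /\
  forall p : bipoly F, irreducible2 p -> dvd2 p f ->
    exists i j : int, (i != 0) || (j != 0) /\ dvd2 p (qscale q i j p).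

(* L T for L = sum_(i <= I) a_i(q^n) N^i *)
Definition apply_op q (I : nat) (a : 'I_I.+1 -> {poly F}) T n k : F :=
  \sum_(i < I.+1) (a i).[q ^+ n] * T (n + i)%N k.

Definition has_qZ_pair q T : Prop :=
  exists (I : nat) (a : 'I_I.+1 -> {poly F}) (G : nat -> nat -> F),
    [/\ exists i, a i != 0,
        qhyper q G &
        forall n k, apply_op q a T n k = G n k.+1 - G n k].

End Bivariate.

(* Main.v *)
From Stdlib Require Import Classical.
From HB Require Import structures.
From mathcomp Require Import all_boot all_order all_algebra.
From mathcomp Require Import zify ring.
Require Import Defs.

(* Call an irreducible [P] in F(x)[y] free if no nontrivial scaling
   [P(q^i x, q^j y)] is a multiple of [P], so that [v] is q-proper iff no free
   [P] divides it. Write w = u / v and h = r / s. Compatibility of the two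
   certificates says that f = R1 * w / w(qx, y) satisfies
   f(x, qy) / f(x, y) = h(qx, y) / h(x, y); comparing poles along the rows
   [P(q^i x, q^j y)], j in Z, shows that h and f have neither zeros nor poles
   along a free [P] (Ore-Sato).

   A qZ-pair is an identity sum_i a_i A_i = R2 * g(x, qy) - g with g rational
   and A_i = N^i T / T. Multiplied by w, its right hand side becomes
   h * G(x, qy) - G, which cannot have exactly one pole on a row of free
   polynomials; if a free [P] divides [v], then by eps-freeness the left hand
   side has exactly one pole on some such row.

   Conversely, the equation A_i(x, qy) / A_i = R2(q^i x, y) / R2 bounds the
   pole orders of the A_i uniformly in i, and the nonfree poles lie in finitely
   many rows. Products over whole segments of these rows give a common
   denominator V of A_0, ..., A_I such that R2 * V / V(x, qy) has degree bounded
   independently of I, and for large I counting unknowns yields a_i and g.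
   Once n is large, a pole of g(q^n, y) at y = q^k would force one at q^(k+1),
   and so on, hence G = g T is defined on the whole grid after replacing L by a
   multiple N^m L. *)

Set Implicit Arguments.
Unset Strict Implicit.
Unset Printing Implicit Defensive.
Import GRing.Theory.
Local Open Scope ring_scope.

(** * Pseudo-divisibility over an integral domain *)

Section PseudoDivision.
Variable R : idomainType.
Implicit Types (P Q f g b : {poly R}) (c : R).

Lemma pdvdP P f :
  reflect (exists c g, c != 0 /\ c *: f = g * P) (P %| f).
Proof.
apply: (iffP (Pdiv.Idomain.dvdpP _ _)) => [[[c g] /= c0 e]|[c [g [c0 e]]]].
  by exists c, g.
by exists (c, g).
Qed.

Lemma irr_size P : irreducible_poly P -> (1 < size P)%N.
Proof. by case. Qed.

Lemma irr_dvd_eqp P Q : irreducible_poly P -> irreducible_poly Q ->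
  P %| Q -> Q %| P.
Proof.
move=> [sP _] [_ irQ] PQ; have /andP[] // : P %= Q.
by apply: irQ => //; rewrite neq_ltn sP orbT.
Qed.

Lemma irr_dvdM P f g : irreducible_poly P ->
  P %| f * g -> (P %| f) \/ (P %| g).
Proof.
move=> irP; case: (boolP (coprimep P f)) => [cop|]; first by rewrite Gauss_dvdpr //; right.
rewrite /coprimep => /(irP.2 _) /(_ (dvdp_gcdl _ _)) /andP[_ h] _; left.
exact: dvdp_trans h (dvdp_gcdr _ _).
Qed.

Lemma irr_ndvdM P f g : irreducible_poly P ->
  ~~ (P %| f) -> ~~ (P %| g) -> ~~ (P %| f * g).
Proof. by move=> irP nf ng; apply/negP => /irr_dvdM[]//; apply/negP. Qed.

Lemma irr_ndvdX P f n : irreducible_poly P -> ~~ (P %| f) -> ~~ (P %| f ^+ n).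
Proof.
move=> irP nf; elim: n => [|n IHn]; last by rewrite exprS irr_ndvdM.
by rewrite expr0 dvdp1 neq_ltn irr_size ?orbT.
Qed.

Lemma irr_ndvdC P c : irreducible_poly P -> c != 0 -> ~~ (P %| c%:P).
Proof.
move=> irP c0; apply/negP => /dvdp_leq; rewrite polyC_eq0 c0 size_polyC c0.
by move/(_ isT); rewrite leqNgt irr_size.
Qed.

Lemma irr_factor f : (1 < size f)%N -> exists2 P, irreducible_poly P & P %| f.
Proof.
have [n] := ubnP (size f); elim: n f => // n IHn f le_f gt1.
have [irf|nirf] := classic (irreducible_poly f); first by exists f.
have [g [s1 gf ngf]] : exists g, [/\ size g != 1%N, g %| f & ~~ (g %= f)].
  apply: NNPP => nex; apply: nirf; split=> // g s1 gf.
  by apply: contraT => ngf; case: nex; exists g.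
have f0 : f != 0 by rewrite -size_poly_gt0 ltnW.
have g0 := dvdpN0 gf f0.
have lt_gf : (size g < size f)%N.
  by rewrite ltn_neqAle (dvdp_leq f0 gf) andbT dvdp_size_eqp.
have [||P irP Pg] := IHn g; first exact: leq_trans lt_gf _.
  by rewrite ltn_neqAle eq_sym s1 size_poly_gt0.
by exists P => //; apply: dvdp_trans gf.
Qed.

(** The strict drop in size drives the inductions that split off irreducible factors. *)
Lemma dvd_quotient P f : f != 0 -> irreducible_poly P -> P %| f ->
  exists c g, [/\ c != 0, c *: f = g * P, g != 0 & (size g < size f)%N].
Proof.
move=> f0 irP /pdvdP[c [g [c0 e]]]; exists c, g.
have g0 : g != 0.
  apply: contra_neq f0 => g0; move: e; rewrite g0 mul0r => /eqP.
  by rewrite -mul_polyC mulf_eq0 polyC_eq0 (negPf c0) => /eqP.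
split=> //; have sP := irr_size irP.
have P0 : P != 0 by rewrite -size_poly_gt0 ltnW.
have := congr1 (fun p : {poly R} => size p) e.
rewrite size_scale // size_mul // => ->.
by move: sP (g0); rewrite -size_poly_gt0; case: (size P) => [|[|n]]//; rewrite !addnS /=; lia.
Qed.

(** Each factor [P] split off lowers the size by at least one; the resulting inequality is the
    budget that later bounds pole orders. *)
Lemma irr_extract P b : irreducible_poly P -> b != 0 ->
  exists k c b', [/\ c != 0, c *: b = P ^+ k * b', ~~ (P %| b'), b' != 0
                   & (k + size b' <= size b)%N].
Proof.
move=> irP; have [n] := ubnP (size b); elim: n b => // n IHn b le_b b0.
case: (boolP (P %| b)) => [Pb|nPb]; last first.
  by exists 0%N, 1, b; rewrite oner_eq0 scale1r expr0 mul1r add0n.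
have [c [g [c0 e g0 lt]]] := dvd_quotient b0 irP Pb.
have [|k [c' [b' [c'0 e' nP b'0 sz]]]] := IHn g _ g0; first exact: leq_trans lt _.
exists k.+1, (c' * c), b'; split=> //; first by rewrite mulf_neq0.
  by rewrite -scalerA e scalerAl e' exprSr mulrAC.
by rewrite addSn (leq_ltn_trans sz).
Qed.

(** Once some [Q i] is split off, every other [Q j] dividing [f] divides the smaller quotient.
    Applied to the translates of one polynomial, this leaves only finitely many zeros and poles
    among them. *)
Lemma finite_irr_divisors (I : eqType) (Q : I -> {poly R}) f :
  (forall i, irreducible_poly (Q i)) -> (forall i j, Q i %| Q j -> i = j) ->
  f != 0 -> exists s : seq I, forall i, Q i %| f -> i \in s.
Proof.
move=> irQ injQ; have [n] := ubnP (size f); elim: n f => // n IHn f le_f f0.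
have [[i Qi]|nQ] := classic (exists i, Q i %| f); last first.
  by exists [::] => i Qi; case: nQ; exists i.
have [c [g [c0 e g0 lt]]] := dvd_quotient f0 (irQ i) Qi.
have [|s sP] := IHn g _ g0; first exact: leq_trans lt _.
exists (i :: s) => j; rewrite -(dvdpZr _ _ c0) e => /(irr_dvdM (irQ j))[/sP|/injQ->].
  by rewrite in_cons orbC => ->.
exact: mem_head.
Qed.

(** Gaussian elimination by cross-multiplication with a pivot [f k] of full size, so that all
    coefficients stay in the domain [R]. *)
Lemma poly_lin_dep (n N : nat) (f : 'I_N -> {poly R}) :
  (n < N)%N -> (forall i, (size (f i) <= n)%N) ->
  exists x : 'I_N -> R, (exists i, x i != 0) /\ \sum_i x i *: f i = 0.
Proof.
elim: n N f => [|n IHn] N f lt_n sf.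
  exists (fun=> 1); split; first by exists (Ordinal lt_n); rewrite oner_eq0.
  by apply: big1 => i _; move: (sf i); rewrite leqn0 size_poly_eq0 => /eqP->; rewrite scaler0.
case: N f lt_n sf => // N f lt_n sf.
have [/forallP sf'|/forallPn[k nk]] := boolP [forall i, (size (f i) <= n)%N].
  by apply: IHn => //; apply: ltnW.
have szk : size (f k) = n.+1 by apply/eqP; rewrite eqn_leq sf ltnNge nk.
have lc0 : (f k)`_n != 0.
  by rewrite -[n]/(n.+1.-1) -szk -lead_coefE lead_coef_eq0 -size_poly_eq0 szk.
pose g j := (f k)`_n *: f (lift k j) - (f (lift k j))`_n *: f k.
have [//||x [[j xj] e]] := IHn N g.
  move=> j; apply/leq_sizeP => m; rewrite leq_eqVlt => /orP[/eqP<-|lt_m].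
    by rewrite coefB !coefZ mulrC subrr.
  have out i : (f i)`_m = 0 by apply/nth_default/(leq_trans (sf i)).
  by rewrite coefB !coefZ !out !mulr0 subrr.
(* These are the coefficients of the [f i] once each [g j] is expanded; the pivot is the index at
   which [unlift] returns [None]. *)
pose y i := oapp (fun j => (f k)`_n * x j) (- \sum_j x j * (f (lift k j))`_n) (unlift k i).
exists y; split.
  by exists (lift k j); rewrite /y liftK /= mulf_neq0.
rewrite (bigD1_ord k) //= {1}/y unlift_none /= scaleNr -[RHS]e addrC scaler_suml -sumrB.
apply: eq_bigr => i _; rewrite /y liftK /g /= scalerBr !scalerA.
by rewrite (mulrC _ (x i)).
Qed.

End PseudoDivision.

(** * Local regularity and marching along rows *)

Section Core.
(** In the application [R] is F[x], [E] is F(x, y), [phi] is the inclusion of F[x, y], and [S i j],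
    [sg i j] replace x, y by q^i x, q^j y. Divisibility in [{poly R}] is that of F(x)[y], so an
    irreducible [P] stands for a prime of F(x)[y]. *)
Variables (R : idomainType) (S : int -> int -> {rmorphism {poly R} -> {poly R}}).
Hypothesis S00 : forall p, S 0 0 p = p.
Hypothesis SS : forall i j k l p, S i j (S k l p) = S (i + k) (j + l) p.
Hypothesis size_S : forall i j p, size (S i j p) = size p.
Variables (E : fieldType) (phi : {rmorphism {poly R} -> E}).
Hypothesis phi_eq0 : forall p, (phi p == 0) = (p == 0).
Hypothesis phi_frac : forall z, exists n d : {poly R}, d != 0 /\ z = phi n / phi d.
Variable sg : int -> int -> {rmorphism E -> E}.
Hypothesis sg_phi : forall i j p, sg i j (phi p) = phi (S i j p).
Implicit Types (P Q f g b n d r t u v : {poly R}) (c : R) (z h w : E) (i j k l J : int).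

Lemma S_eq0 i j f : (S i j f == 0) = (f == 0).
Proof. by rewrite -!size_poly_eq0 size_S. Qed.

Lemma S_polyC i j c : c != 0 -> exists2 c', c' != 0 & S i j c%:P = c'%:P.
Proof.
move=> c0; have sz : size (S i j c%:P) = 1%N by rewrite size_S size_polyC c0.
have e : S i j c%:P = ((S i j c%:P)`_0)%:P by apply: size1_polyC; rewrite sz.
exists (S i j c%:P)`_0 => //; apply/eqP => z0.
by move: sz; rewrite e z0 polyC0 size_poly0.
Qed.

Lemma dvd_S_imp i j P f : P %| f -> S i j P %| S i j f.
Proof.
move=> /pdvdP[c [g [c0 e]]]; have [c' c'0 e'] := S_polyC i j c0.
apply/pdvdP; exists c', (S i j g); split=> //.
by rewrite -mul_polyC -e' -!rmorphM -e mul_polyC.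
Qed.

Lemma SK i j f : S (- i) (- j) (S i j f) = f.
Proof. by rewrite SS !addNr S00. Qed.

Lemma SKV i j f : S i j (S (- i) (- j) f) = f.
Proof. by rewrite SS !subrr S00. Qed.

Lemma dvd_S i j P f : (S i j P %| S i j f) = (P %| f).
Proof.
apply/idP/idP; last exact: dvd_S_imp.
by move/(dvd_S_imp (- i) (- j)); rewrite !SK.
Qed.

Lemma dvd_Sl i j P f : (S i j P %| f) = (P %| S (- i) (- j) f).
Proof. by rewrite -(dvd_S (- i) (- j)) SK. Qed.

Lemma irr_S i j P : irreducible_poly P -> irreducible_poly (S i j P).
Proof.
move=> [sP irP]; split; first by rewrite size_S.
move=> Q sQ QP; have := irP (S (- i) (- j) Q); rewrite size_S => /(_ sQ).
rewrite -(dvd_S i j) SS !subrr S00 => /(_ QP) /andP[h1 h2].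
by rewrite /eqp QP /= -[Q](SKV i j) dvd_S.
Qed.

Lemma phi_neq0 f : f != 0 -> phi f != 0.
Proof. by rewrite phi_eq0. Qed.

Lemma phi_inj f g : phi f = phi g -> f = g.
Proof. by move=> e; apply/eqP; rewrite -subr_eq0 -phi_eq0 rmorphB e subrr. Qed.

Lemma sg00 z : sg 0 0 z = z.
Proof. by have [n [d [_ ->]]] := phi_frac z; rewrite fmorph_div !sg_phi !S00. Qed.

Lemma sgsg i j k l z : sg i j (sg k l z) = sg (i + k) (j + l) z.
Proof. by have [n [d [_ ->]]] := phi_frac z; rewrite !fmorph_div !sg_phi !SS. Qed.

(* [z] has no pole along [P] *)
Definition reg P z := exists n d, ~~ (P %| d) /\ z * phi d = phi n.

Lemma ndvd_neq0 P d : ~~ (P %| d) -> d != 0.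
Proof. by apply: contraNneq => ->; rewrite dvdp0. Qed.

Lemma reg_phi P f : irreducible_poly P -> reg P (phi f).
Proof.
move=> irP; exists f, 1; split; last by rewrite rmorph1 mulr1.
by rewrite dvdp1 neq_ltn irr_size ?orbT.
Qed.

Lemma regD P z w : irreducible_poly P -> reg P z -> reg P w -> reg P (z + w).
Proof.
move=> irP [n [d [nd e]]] [n' [d' [nd' e']]].
exists (n * d' + n' * d), (d * d'); split; first exact: irr_ndvdM.
by rewrite rmorphD !rmorphM -e -e'; ring.
Qed.

Lemma regN P z : reg P z -> reg P (- z).
Proof. by move=> [n [d [nd e]]]; exists (- n), d; rewrite mulNr e rmorphN. Qed.

Lemma regB P z w : irreducible_poly P -> reg P z -> reg P w -> reg P (z - w).
Proof. by move=> irP rz rw; apply: regD => //; apply: regN. Qed.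

Lemma regM P z w : irreducible_poly P -> reg P z -> reg P w -> reg P (z * w).
Proof.
move=> irP [n [d [nd e]]] [n' [d' [nd' e']]].
exists (n * n'), (d * d'); split; first exact: irr_ndvdM.
by rewrite !rmorphM -e -e'; ring.
Qed.

Lemma reg_prod P (I : Type) (s : seq I) (p : pred I) (F : I -> E) :
  irreducible_poly P -> (forall x, reg P (F x)) ->
  reg P (\prod_(x <- s | p x) F x).
Proof.
move=> irP rF; elim/big_ind: _ => // [|x y]; last exact: regM.
by rewrite -(rmorph1 phi); apply: reg_phi.
Qed.

Lemma reg_sum P (I : Type) (s : seq I) (p : pred I) (F : I -> E) :
  irreducible_poly P -> (forall x, p x -> reg P (F x)) ->
  reg P (\sum_(x <- s | p x) F x).
Proof.
move=> irP rF; elim/big_ind: _ => // [|x y]; last exact: regD.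
by rewrite -(rmorph0 phi); apply: reg_phi.
Qed.

Lemma reg_inv P d : ~~ (P %| d) -> reg P (phi d)^-1.
Proof.
move=> nd; exists 1, d; split=> //; rewrite mulVf ?rmorph1 //.
exact/phi_neq0/(ndvd_neq0 nd).
Qed.

Lemma reg_frac P n d : irreducible_poly P -> ~~ (P %| d) -> reg P (phi n / phi d).
Proof. by move=> irP nd; apply: regM => //; [apply: reg_phi|apply: reg_inv]. Qed.

Lemma reg_s_imp i j P z : reg P z -> reg (S i j P) (sg i j z).
Proof.
move=> [n [d [nd e]]]; exists (S i j n), (S i j d).
by rewrite dvd_S -!sg_phi -rmorphM e.
Qed.

Lemma reg_s i j P z : reg (S i j P) (sg i j z) <-> reg P z.
Proof.
split; last exact: reg_s_imp.
by move/(reg_s_imp (- i) (- j)); rewrite SK sgsg !addNr sg00.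
Qed.

Lemma pole_frac P z n d : irreducible_poly P ->
  z * phi d = phi n -> P %| d -> ~~ (P %| n) -> ~ reg P z.
Proof.
move=> irP e Pd Pn [n0 [d0 [nd0 e0]]].
have : n * d0 = n0 * d by apply: phi_inj; rewrite !rmorphM -e -e0; ring.
move=> e1; have : P %| n * d0 by rewrite e1 dvdp_mull.
by move/(irr_dvdM irP) => [|]; apply/negP.
Qed.

(** The translates of [P] in y are pairwise non-associate. For the scalings, [dvd_X_or_row_inf]
    shows that among irreducibles only the associates of y fail this. *)
Definition row_inf P := forall j, P %| S 0 j P -> j = 0.

Lemma row_inf_S i j P : row_inf P -> row_inf (S i j P).
Proof.
by move=> rP k; rewrite SS (addrC 0) (addrC k) -SS dvd_S => /rP.
Qed.

(** Only finitely many of the pairwise non-associate translates divide a denominator of [z]. *)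
Lemma row_far P z : irreducible_poly P -> row_inf P ->
  exists M : nat, forall j, (M < `|j|)%N -> reg (S 0 j P) z.
Proof.
move=> irP rP; have [n [d [d0 ez]]] := phi_frac z.
have [||s sP] := @finite_irr_divisors _ _ (fun j => S 0 j P) d _ _ d0.
- by move=> j; apply: irr_S.
- move=> j k /=; rewrite dvd_Sl SS oppr0 addr0 => /rP e.
  by apply/eqP; rewrite eq_sym -subr_eq0 addrC e.
exists (\max_(j <- s) `|j|%N) => j lt_j; exists n, d; split; last first.
  by rewrite ez mulfVK // phi_neq0.
by apply: contraTN lt_j => /sP js; rewrite -leqNgt; apply: leq_bigmax_seq.
Qed.

(** [sg 0 1 z] at [S 0 j P] is [z] at [S 0 (j - 1) P], so the hypothesis carries regularity one
    place down; the descent starts far up the row, where [row_far] supplies it. *)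
Lemma march_down P z J : irreducible_poly P -> row_inf P ->
  (forall j, (J < j)%R -> reg (S 0 j P) z -> reg (S 0 j P) (sg 0 1 z)) ->
  forall j, (J <= j)%R -> reg (S 0 j P) z.
Proof.
move=> irP rP step; have [M far] := row_far z irP rP.
suff H (m : nat) : forall j, (J <= j)%R -> (M%:Z + 1 - j <= m%:Z)%R -> reg (S 0 j P) z.
  by move=> j Jj; apply: (H (absz (M%:Z + 1 - j)%R)) => //; lia.
elim: m => [|m IHm] j Jj le_j; first by apply: far; lia.
apply/(reg_s 0 1); rewrite SS add0r; apply: step; first by lia.
by apply: IHm; lia.
Qed.

(** Mirror image of [march_down], starting from the far negative end of the row. *)
Lemma march_up P z J : irreducible_poly P -> row_inf P ->
  (forall j, (j <= J)%R -> reg (S 0 j P) (sg 0 1 z) -> reg (S 0 j P) z) ->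
  forall j, (j <= J)%R -> reg (S 0 j P) z.
Proof.
move=> irP rP step; have [M far] := row_far z irP rP.
suff H (m : nat) : forall j, (j <= J)%R -> (j + M%:Z + 1 <= m%:Z)%R -> reg (S 0 j P) z.
  by move=> j Jj; apply: (H (absz (j + M%:Z + 1)%R)) => //; lia.
elim: m => [|m IHm] j Jj le_j; first by apply: far; lia.
apply: step => //; have -> : S 0 j P = S 0 1 (S 0 (j - 1) P).
  by rewrite SS add0r addrCA subrr addr0.
by apply/reg_s/IHm; lia.
Qed.

(** * Free polynomials and the Ore-Sato argument *)

Definition free P := forall i j, P %| S i j P -> i = 0 /\ j = 0.

Lemma free_row_inf P : free P -> row_inf P.
Proof. by move=> fP j /fP[]. Qed.

Lemma free_S i j P : free P -> free (S i j P).
Proof. by move=> fP k l; rewrite SS (addrC k) (addrC l) -SS dvd_S => /fP. Qed.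

(** Finitely many translates of a free [P] divide [f], so their first indices are bounded by some
    [M]; the induction on [M - i] climbs to a translate with nothing above it. *)
Lemma free_top_row P f : irreducible_poly P -> free P -> f != 0 -> P %| f ->
  exists i j, S i j P %| f /\ forall k l, (0 < k)%R -> ~~ (S k l (S i j P) %| f).
Proof.
move=> irP fP f0 Pf.
have [||s sP] := @finite_irr_divisors _ _ (fun ij => S ij.1 ij.2 P) f _ _ f0.
- by move=> ij; apply: irr_S.
- move=> [i j] [k l] /=; rewrite dvd_Sl SS => /fP[e1 e2].
  by congr pair; lia.
set M := \max_(ij <- s) `|ij.1|%N.
have bnd i j : S i j P %| f -> (`|i| <= M)%N.
  by move/(sP (i, j)) => js; apply: (@leq_bigmax_seq _ _ predT (fun ij : int * int => `|ij.1|%N) _ js).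
suff H (m : nat) : forall i j, S i j P %| f -> (M%:Z - i <= m%:Z)%R ->
    exists i j, S i j P %| f /\ forall k l, (0 < k)%R -> ~~ (S k l (S i j P) %| f).
  by apply: (H M 0 0); rewrite ?S00 ?subr0.
elim: m => [|m IHm] i j Sf le_i.
  exists i, j; split=> // k l k0; rewrite SS; apply/negP => /bnd; lia.
have [[k [l [k0 kl]]]|nex] :=
    classic (exists k l, (0 < k)%R /\ S k l (S i j P) %| f); last first.
  by exists i, j; split=> // k l k0; apply/negP => kl; apply: nex; exists k, l.
by move: kl; rewrite SS => /IHm; apply; lia.
Qed.

Definition row_coprime f g :=
  forall k P, irreducible_poly P -> P %| f -> ~~ (P %| S 0 k g).

Lemma row_coprimeC f g : row_coprime f g -> row_coprime g f.
Proof.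
move=> fg k P irP Pg; apply/negP => Pf.
have := fg (- k) (S 0 (- k) P) (irr_S 0 (- k) irP).
by rewrite dvd_Sl oppr0 opprK dvd_S Pg => /(_ Pf).
Qed.

(** With [rho] regular on the row, regularity of [z] passes downwards, and regularity of [z^-1]
    passes upwards since [z^-1 = rho * (sg 0 1 z)^-1]. Both are regular at the far ends, so each
    march sweeps the whole row. *)
Lemma march_quotient P z rho : irreducible_poly P -> row_inf P -> z != 0 ->
  sg 0 1 z = rho * z -> (forall j, reg (S 0 j P) rho) ->
  forall j, reg (S 0 j P) z /\ reg (S 0 j P) z^-1.
Proof.
move=> irP rP z0 e rrho j; split.
  apply: (@march_down P z j) => // k _ rz; rewrite e; apply: regM => //.
  exact: irr_S.
apply: (@march_up P z^-1 j) => // k _; rewrite fmorphV => rz.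
have sz0 : sg 0 1 z != 0 by rewrite fmorph_eq0.
have -> : z^-1 = rho * (sg 0 1 z)^-1.
  by rewrite e invfM mulrA divff ?mul1r //; apply: contraNneq sz0 => r0; rewrite e r0 mul0r.
by apply: regM => //; apply: irr_S.
Qed.

(** Take the topmost free factor [P] of [r] and look one x-step above it, on the row of [Q]. There
    [r] has no factor by maximality, and [S 1 0 t] has none by row coprimality, so the multiplier
    [rho] of [f] has no pole on that row; yet [S 1 0 r] gives it a zero at [Q]. *)
Lemma ore_sato_num r t (f : E) P : r != 0 -> t != 0 -> f != 0 -> row_coprime r t ->
  sg 0 1 f * (phi r / phi t) = sg 1 0 (phi r / phi t) * f ->
  irreducible_poly P -> free P -> ~~ (P %| r).
Proof.
move=> r0 t0 f0 rt e irP0 fP0; apply/negP => /(free_top_row irP0 fP0 r0).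
move=> [i [j [Pr top]]]; move: (S i j P) (irr_S i j irP0) (@free_S i j _ fP0) Pr top.
move=> {i j irP0 fP0}P irP fP Pr top.
pose Q := S 1 0 P; have irQ : irreducible_poly Q by apply: irr_S.
have rQ : row_inf Q by apply/free_row_inf/free_S.
have Qr j : ~~ (S 0 j Q %| r) by rewrite SS; have := top 1 j isT; rewrite add0r addr0.
have Qt j : ~~ (S 0 j Q %| S 1 0 t).
  rewrite SS add0r addr0 dvd_Sl SS addNr addr0.
  exact: rt.
have st0 : S 1 0 t != 0 by rewrite S_eq0.
have sr0 : S 1 0 r != 0 by rewrite S_eq0.
pose rho := phi (S 1 0 r * t) / phi (S 1 0 t * r).
have p0 := (phi_neq0 r0, phi_neq0 t0, phi_neq0 sr0, phi_neq0 st0).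
have erho : sg 0 1 f = rho * f.
  apply: (mulIf (_ : phi r / phi t != 0)); first by rewrite mulf_neq0 ?invr_eq0 ?p0.
  rewrite e fmorph_div !sg_phi /rho !rmorphM; field.
  by rewrite !p0.
have rrho k : reg (S 0 k Q) rho.
  by apply: reg_frac; [apply: irr_S|apply: irr_ndvdM => //; apply: irr_S].
have H := march_quotient irQ rQ f0 erho rrho.
(* A zero of [rho] is a pole of [rho^-1 = f / sg 0 1 f], but [f] and its inverse are regular on the
   whole row. *)
have [] : ~ reg Q rho^-1.
  apply: (@pole_frac Q _ (S 1 0 t * r) (S 1 0 r * t)) => //.
  - rewrite /rho invf_div mulfVK //; apply: phi_neq0; exact: mulf_neq0.
  - by apply: dvdp_mulr; rewrite dvd_S.
  - by apply: irr_ndvdM => //; [have := Qt 0|have := Qr 0]; rewrite S00.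
have -> : rho^-1 = f * (sg 0 1 f)^-1 by rewrite erho [(rho * f)^-1]invfM mulrCA divff ?mulr1.
apply: regM => //; first by have [] := H 0; rewrite S00.
have [_ h] := H (-1); have := (reg_s_imp 0 1 h).
by rewrite SS addr0 subrr S00 fmorphV.
Qed.

(** Inverting the equation exchanges [r] and [t], so [ore_sato_num] clears both of free factors; the
    multiplier of [f] is then regular on the row and [march_quotient] applies. *)
Lemma ore_sato r t (f : E) P : r != 0 -> t != 0 -> f != 0 -> row_coprime r t ->
  sg 0 1 f * (phi r / phi t) = sg 1 0 (phi r / phi t) * f ->
  irreducible_poly P -> free P ->
  [/\ ~~ (P %| r), ~~ (P %| t), reg P f & reg P f^-1].
Proof.
move=> r0 t0 f0 rt e irP fP.
have sx0 (x : {poly R}) i j : x != 0 -> sg i j (phi x) != 0.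
  by move=> x0; rewrite sg_phi phi_neq0 // S_eq0.
have e' : sg 0 1 f^-1 * (phi t / phi r) = sg 1 0 (phi t / phi r) * f^-1.
  by rewrite -(invf_div (phi r)) !fmorphV -!invfM e.
have nr Q : irreducible_poly Q -> free Q -> ~~ (Q %| r).
  exact: (ore_sato_num r0 t0 f0 rt e).
have nt Q : irreducible_poly Q -> free Q -> ~~ (Q %| t).
  by apply: (@ore_sato_num t r f^-1) => //; [rewrite invr_eq0|apply: row_coprimeC].
pose rho := phi (S 1 0 r * t) / phi (S 1 0 t * r).
have [|||rf rf'] := @march_quotient P f rho irP _ f0 _ _ 0.
- exact: free_row_inf.
- have p0 := (phi_neq0 r0, phi_neq0 t0).
  apply: (mulIf (_ : phi r / phi t != 0)); first by rewrite mulf_neq0 ?invr_eq0 ?p0.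
  rewrite e fmorph_div !sg_phi /rho !rmorphM; field.
  by rewrite !p0 -sg_phi sx0.
- move=> j; have irQ := irr_S 0 j irP; have fQ := @free_S 0 j _ fP.
  apply: reg_frac => //; apply: irr_ndvdM => //; last exact: nr.
  by rewrite -[S 0 j P](SKV 1 0) dvd_S nt //; [apply: irr_S|apply: free_S].
by move: rf rf'; rewrite S00; split=> //; [apply: nr|apply: nt].
Qed.

(** For [z] the certificate R1 this is the rational function N^m T / T. *)
Definition shift_prod z (m : nat) := \prod_(j < m) sg j 0 z.

Lemma shift_prodS z m : shift_prod z m.+1 = shift_prod z m * sg m 0 z.
Proof. by rewrite /shift_prod big_ord_recr. Qed.

Lemma sgC i j k l z : sg i j (sg k l z) = sg k l (sg i j z).
Proof. by rewrite !sgsg (addrC i) (addrC j). Qed.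

Lemma shift_prod_comm z h m :
  sg 0 1 z * h = sg 1 0 h * z ->
  sg 0 1 (shift_prod z m) * h = sg m 0 h * shift_prod z m.
Proof.
move=> e; elim: m => [|m IHm].
  by rewrite /shift_prod big_ord0 rmorph1 mul1r sg00 mulr1.
have e2 : sg 0 1 (sg m 0 z) * sg m 0 h = sg m.+1 0 h * sg m 0 z.
  by rewrite sgC -rmorphM e rmorphM sgsg addr0 -PoszD addn1.
rewrite shift_prodS rmorphM mulrAC IHm.
by transitivity (shift_prod z m * (sg 0 1 (sg m 0 z) * sg m 0 h)); [|rewrite e2]; ring.
Qed.

(** The factor [sg j 0 f] at [P] is [f] at the translate [S (- j) 0 P], which is again free. *)
Lemma free_reg_shift_prod r t (f : E) P m :
  r != 0 -> t != 0 -> f != 0 -> row_coprime r t ->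
  sg 0 1 f * (phi r / phi t) = sg 1 0 (phi r / phi t) * f ->
  irreducible_poly P -> free P ->
  reg P (shift_prod f m) /\ reg P (shift_prod f m)^-1.
Proof.
move=> r0 t0 f0 rt e irP fP; rewrite /shift_prod -prodfV; split; apply: reg_prod => // j;
  have [_ _ h1 h2] := ore_sato r0 t0 f0 rt e (irr_S (- j%:Z) 0 irP) (@free_S (- j%:Z) 0 _ fP);
  have := reg_s_imp j 0 h1; have := reg_s_imp j 0 h2;
  by rewrite SS subrr addr0 S00 ?fmorphV.
Qed.

(* The row of the topmost free pole of [u / v], shifted by the order of the
   operator, carries exactly one pole of the left hand side, whereas the right
   hand side can never have exactly one pole on a row. *)
Lemma telescoper_no_free r t u v (f g : E) (a : nat -> R) (I : nat) P :
  r != 0 -> t != 0 -> f != 0 -> v != 0 -> row_coprime r t ->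
  sg 0 1 f * (phi r / phi t) = sg 1 0 (phi r / phi t) * f ->
  (forall P, irreducible_poly P -> P %| v -> ~~ (P %| u)) ->
  (forall P m, irreducible_poly P -> P %| v -> P %| S 0 m v -> m = 0) ->
  a I != 0 ->
  \sum_(i < I.+1) phi (a i)%:P * shift_prod f i * sg i 0 (phi u / phi v) =
    phi r / phi t * sg 0 1 g - g ->
  irreducible_poly P -> free P -> ~~ (P %| v).
Proof.
move=> r0 t0 f0 v0 rt e uv epsv aI eq irP0 fP0.
apply/negP => /(free_top_row irP0 fP0 v0).
move=> [i [j [Pv top]]]; move: (S i j P) (irr_S i j irP0) (@free_S i j _ fP0) Pv top.
move=> {i j irP0 fP0}P irP fP Pv top.
pose Q := S I 0 P; have irQ : irreducible_poly Q by apply: irr_S.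
have fQ : free Q by apply: free_S.
have rQ := free_row_inf fQ.
have irQj j : irreducible_poly (S 0 j Q) by apply: irr_S.
have fQj j : free (S 0 j Q) by apply: free_S.
have fm j m := free_reg_shift_prod m r0 t0 f0 rt e (irQj j) (@fQj j).
have hreg j : reg (S 0 j Q) (phi r / phi t) /\ reg (S 0 j Q) (phi r / phi t)^-1.
  have [nr nt _ _] := ore_sato r0 t0 f0 rt e (irQj j) (@fQj j).
  by rewrite invf_div; split; apply: reg_frac.
(* A pole here means that [S (I - m) j P] divides [v]. For [m < I] the choice of the topmost row
   forbids it; for [m = I] eps-freeness allows only [j = 0]. *)
have vreg j (m : nat) : (m < I)%N || (j != 0) && (m <= I)%N ->
    reg (S 0 j Q) (sg m 0 (phi u / phi v)).
  move=> cond; rewrite fmorph_div !sg_phi; apply: reg_frac => //.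
  rewrite SS add0r addr0 -[S I j P](SKV m 0) dvd_S SS oppr0 add0r.
  case: ltnP cond => [lt_m _|le_m /= /andP[j0 le_m']].
    by apply: top; lia.
  have -> : m = I by apply/eqP; rewrite eqn_leq le_m le_m'.
  rewrite addNr; apply/negP => h; case/eqP: j0.
  apply/eqP; rewrite -oppr_eq0; apply/eqP; apply: (epsv P) => //.
  by rewrite -(SK 0 j P) oppr0 dvd_S.
set lhs := (X in X = _) in eq.
have lreg j : j != 0 -> reg (S 0 j Q) lhs.
  move=> j0; apply: reg_sum => // m _; apply: regM => //; last first.
    by apply: vreg; apply/orP; right; rewrite j0 -ltnS ltn_ord.
  by apply: regM => //; [apply: reg_phi|have [] := fm j m].
(* All summands but the last are regular at [Q]; in the last, [a I] and the shift product are units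
   at [Q], so the pole of the shifted [u / v] survives. *)
have lnreg : ~ reg Q lhs.
  rewrite /lhs big_ord_recr /= => rl.
  have QE : S 0 0 Q = Q by rewrite S00.
  have : reg Q (phi (a I)%:P * shift_prod f I * sg I 0 (phi u / phi v)).
    rewrite -[X in reg _ X](addKr (\sum_(i < I) phi (a i)%:P * shift_prod f i * sg i 0 (phi u / phi v))).
    rewrite addrC; apply: regB => //; apply: reg_sum => // m _; apply: regM => //.
      by apply: regM => //; [apply: reg_phi|rewrite -QE; have [] := fm 0 m].
    by rewrite -QE; apply: vreg; rewrite ltn_ord.
  have aI' : ~~ (Q %| (a I)%:P) by apply: irr_ndvdC.
  have [_ sI] := fm 0 I; rewrite QE in sI.
  move=> h; have := regM irQ (regM irQ (reg_inv aI') sI) h.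
  set w := sg I 0 _; set x := phi _; set y := shift_prod _ _ => h'.
  have x0 : x != 0 by apply: phi_neq0; rewrite polyC_eq0.
  have y0 : y != 0 by apply/prodf_neq0 => k _; rewrite fmorph_eq0.
  have e' : x^-1 * y^-1 * (x * y * w) = w.
    by rewrite -invfM mulKf ?mulf_neq0.
  rewrite e' in h'; apply: (@pole_frac Q w (S I 0 u) (S I 0 v)) h' => //.
  - by rewrite /w fmorph_div !sg_phi mulfVK // phi_neq0 // S_eq0.
  - by rewrite dvd_S.
  - by rewrite dvd_S; apply: uv.
(* As [lhs] is regular off [j = 0], marching from above makes [g] regular down to [j = 0], and
   marching from below makes it regular up to [j = -1]. At [Q] the right hand side involves [g] at
   exactly these two places. *)
have g_ge j : (0 <= j)%R -> reg (S 0 j Q) g.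
  apply: (@march_down Q g 0) => // {}j j0 rg.
  have h0 : phi r / phi t != 0 by rewrite mulf_neq0 ?invr_eq0 ?phi_neq0.
  have -> : sg 0 1 g = (phi r / phi t)^-1 * (lhs + g) by rewrite eq subrK mulKf.
  apply: regM => //; first by have [] := hreg j.
  by apply: regD => //; apply: lreg; lia.
have g_lt j : (j <= -1)%R -> reg (S 0 j Q) g.
  apply: (@march_up Q g (-1)) => // {}j j0 rg.
  have -> : g = phi r / phi t * sg 0 1 g - lhs by rewrite eq; ring.
  apply: regB => //; last by apply: lreg; lia.
  by apply: regM => //; have [] := hreg j.
apply: lnreg; rewrite eq -(S00 Q); apply: regB => //; last exact: g_ge.
apply: regM => //; first by have [] := hreg 0.
have -> : S 0 0 Q = S 0 1 (S 0 (-1) Q) by rewrite SS addr0 subrr.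
exact/reg_s/g_lt.
Qed.

(** * Bounded poles and telescoping denominators *)

(** Descending the row from where [z] is regular, each step raises the pole order by at most the
    multiplicity in [d] of the member passed; these multiplicities add up to at most the size of
    [d]. *)
Lemma pole_bound P z n d : irreducible_poly P -> row_inf P -> d != 0 ->
  sg 0 1 z * phi d = phi n * z -> reg P (phi P ^+ size d * z).
Proof.
move=> irP rP d0 e; have [M far] := row_far z irP rP.
have irQ j : irreducible_poly (S 0 j P) by apply: irr_S.
(* Invariant: [k] is the pole order allowed so far, and [b] is what remains of [d] after removing
   the members passed. Regularity of [b / d] says that [b] keeps the full multiplicity of all
   members still to come. *)
suff H (m : nat) : forall j, (M%:Z + 1 - j <= m%:Z)%R ->
    exists (k : nat) b, [/\ b != 0, (k + size b <= size d)%N,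
      forall l, (l <= j)%R -> reg (S 0 l P) (phi b / phi d)
      & reg (S 0 j P) (phi (S 0 j P) ^+ k * z)].
  have [|k [b [b0 le_k _]]] := H M.+1 0; first by lia.
  rewrite S00 => rk; have le_k' : (k <= size d)%N by lia.
  rewrite -(subnK le_k') exprD -mulrA; apply: regM => //.
  by rewrite -rmorphXn; apply: reg_phi.
have pd0 := phi_neq0 d0.
elim: m => [|m IHm] j le_j.
  exists 0%N, d; split=> // [l _|]; first by rewrite divff // -(rmorph1 phi); apply: reg_phi.
  by rewrite expr0 mul1r; apply: far; lia.
have [|k [b [b0 le_k regb regz]]] := IHm (j + 1); first by lia.
set Q := S 0 (j + 1) P in regz.
have irQ' : irreducible_poly Q by apply: irr_S.
have [k' [c [b' [c0 eb nQ b'0 le_b']]]] := irr_extract (irQ (j + 1)) b0.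
have pc0 : phi c%:P != 0 by rewrite phi_neq0 ?polyC_eq0.
have Q0 : Q != 0 by apply: irredp_neq0.
have ephi : phi c%:P * phi b = phi Q ^+ k' * phi b'.
  by rewrite -rmorphXn -!rmorphM mul_polyC eb.
have pQ0 := expf_neq0 k' (phi_neq0 Q0); have pb'0 := phi_neq0 b'0.
exists (k + k')%N, b'; split=> //; first by clear -le_k le_b'; lia.
- move=> l le_l; have -> : phi b' / phi d = phi c%:P * (phi b / phi d) * (phi (Q ^+ k'))^-1.
    by rewrite mulrA ephi rmorphXn mulrAC [_ * phi b']mulrC mulfK.
  apply: regM => //.
    by apply: regM => //; [apply: reg_phi|apply: regb; clear -le_l; lia].
  apply/reg_inv/irr_ndvdX => //; rewrite dvd_Sl SS oppr0 addr0.
  by apply/negP => /rP {}e; clear -e le_l; lia.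
- have -> : S 0 j P = S 0 (-1) Q by rewrite SS addrCA addNr !addr0.
  apply/(reg_s 0 1); rewrite rmorphM rmorphXn sg_phi !SKV.
  have -> : phi Q ^+ (k + k') * sg 0 1 z =
      phi c%:P * (phi b / phi d) * (phi b')^-1 * phi n * (phi Q ^+ k * z).
    have -> : sg 0 1 z = phi n * z / phi d by rewrite -e mulfK.
    by rewrite [phi c%:P * (_ / _)]mulrA ephi exprD; field; rewrite pd0 pb'0.
  apply: regM => //; apply: regM => //; last exact: reg_phi.
  apply: regM => //; last exact: reg_inv.
  by apply: regM => //; [apply: reg_phi|apply: regb; clear; lia].
Qed.

(** [V] is a common multiple of the shifts of [f] up to order [I] and may grow with [I], while the
    ratio [V / V(x, qy) = al / be] stays of bounded size. *)
Definition tame f := exists D : nat, forall I : nat, exists V al be : {poly R},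
  [/\ V != 0, al != 0 /\ be != 0, (size al <= D)%N /\ (size be <= D)%N,
      V * be = S 0 1 V * al
    & forall m : nat, (m <= I)%N -> S m 0 f %| V].

Lemma size_mul_le f g D D' : (size f <= D)%N -> (size g <= D')%N ->
  (size (f * g)%R <= D + D')%N.
Proof. by move=> h h'; have := size_polyMleq f g; lia. Qed.

Lemma tameM f g : tame f -> tame g -> tame (f * g).
Proof.
move=> [D H] [D' H']; exists (D + D')%N => I.
have [V [al [be [V0 [al0 be0] [sal sbe] e dv]]]] := H I.
have [V' [al' [be' [V'0 [al'0 be'0] [sal' sbe'] e' dv']]]] := H' I.
exists (V * V'), (al * al'), (be * be'); split; rewrite ?mulf_neq0 //.
- by split; apply: size_mul_le.
- by rewrite rmorphM mulrACA e e' mulrACA.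
- by move=> m le_m; rewrite rmorphM dvdp_mul ?dv ?dv'.
Qed.

Lemma tame1 : tame 1.
Proof.
exists 1%N => I; exists 1, 1, 1; rewrite oner_eq0 size_poly1 rmorph1; split=> //.
by move=> m _; rewrite rmorph1.
Qed.

Lemma dvd_S_iter P i j (t : nat) : P %| S i j P -> P %| S (i * t) (j * t) P.
Proof.
move=> h; elim: t => [|t IHt]; first by rewrite !mulr0 S00.
have := dvd_S_imp i j IHt; rewrite SS => h'.
by have := dvdp_trans h h'; rewrite intS !mulrDr !mulr1.
Qed.

(** A nontrivial period has nonzero first index because the row is infinite, and its sign can be
    reversed because divisibility between irreducibles is symmetric. *)
Lemma nonfree_period P : irreducible_poly P -> row_inf P -> ~ free P ->
  exists (a : nat) (b : int), (0 < a)%N /\ P %| S a b P.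
Proof.
move=> irP rP nf; apply: NNPP => nex; apply: nf => i j h.
have h' : P %| S (- i) (- j) P.
  rewrite -(dvd_S i j) SKV; exact: irr_dvd_eqp irP (irr_S i j irP) h.
have [i0|i0|i0] := Order.TotalTheory.ltgtP i 0; last 1 first.
- by rewrite i0 in h *; split=> //; apply: rP.
- by case: nex; exists (absz i), (- j); split; [lia|rewrite (_ : Posz _ = - i) //; lia].
- by case: nex; exists (absz i), j; split; [lia|rewrite (_ : Posz _ = i) //; lia].
Qed.

(** For [m = c + a t] with [c < a], the period makes [S m 0 P] associate to [S c (- b t) P]. So the
    shifts occupy [a] rows at heights at most [|b| I]. Taking the product over the full segment from
    [-M] to [M] in each row makes [V / V(x, qy)] telescope to one end factor per row above and
    below. *)
Lemma tame_nonfree P : irreducible_poly P -> row_inf P -> ~ free P -> tame P.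
Proof.
move=> irP rP nf; have [a [b [a0 Pab]]] := nonfree_period irP rP nf.
have P0 : P != 0 by apply: irredp_neq0.
have aux (x : int) (N : nat) : (absz x <= N)%N ->
    (absz (N%:Z - x)%R < (N + N).+1)%N /\ (absz (N%:Z - x)%R)%:Z - N%:Z = - x.
  by clear; lia.
have szP (f : 'I_a -> {poly R}) : (forall x, size (f x) = size P) ->
    (size (\prod_x f x)%R <= a * size P + 1)%N.
  move=> sf; apply: leq_trans (size_poly_prod_leq _ _) _.
  by rewrite (eq_bigr (fun=> size P)) // sum_nat_const card_ord; clear; lia.
exists (a * size P + 1)%N => I; pose M : nat := (`|b| * I)%N; pose m : nat := (M + M).+1.
pose W (c : 'I_a) := \prod_(l < m) S c (l%:Z - M%:Z) P.
exists (\prod_x W x), (\prod_(c < a) S c (- M%:Z) P), (\prod_(c < a) S c (m%:Z - M%:Z) P).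
split.
- by apply/prodf_neq0 => c _; apply/prodf_neq0 => l _; rewrite S_eq0.
- by split; apply/prodf_neq0 => c _; rewrite S_eq0.
- by split; apply: szP => c; rewrite size_S.
- rewrite rmorph_prod -!big_split /=; apply: eq_bigr => c _.
  transitivity (\prod_(l < m.+1) S c (l%:Z - M%:Z) P); first by rewrite big_ord_recr.
  rewrite big_ord_recl /= sub0r mulrC /W rmorph_prod.
  by congr (_ * _); apply: eq_bigr => l _; rewrite SS add0r addrA.
- move=> i le_i; have lt_c : (i %% a < a)%N by rewrite ltn_mod.
  pose t := (i %/ a)%N; have le_t : (t <= I)%N by apply: leq_trans (leq_div _ _) le_i.
  have le_bt : (absz (b * t%:Z)%R <= M)%N by rewrite abszM leq_mul2l le_t orbT.
  have [lt_l el] := aux _ _ le_bt.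
  apply: (@dvdp_trans _ (W (Ordinal lt_c))); last by rewrite (bigD1 (Ordinal lt_c)) //= dvdp_mulIl.
  apply: (@dvdp_trans _ (S (i %% a)%N (- (b * t%:Z)) P)); last first.
    rewrite /W (bigD1 (Ordinal lt_l)) //= el; apply: dvdp_mulIl.
  have h := irr_dvd_eqp irP (irr_S _ _ irP) (dvd_S_iter t Pab).
  have -> : S i 0 P = S (i %% a)%N (- (b * t%:Z)) (S (a%:Z * t%:Z) (b * t%:Z) P).
    rewrite SS addNr; congr (S _ 0 P); by rewrite {1}(divn_eq i a) PoszD PoszM addrC (mulrC a%:Z).
  by rewrite dvd_S.
Qed.

(** Collects the nonfree factors with infinite row; free factors and associates of y are skipped,
    their poles being handled by other means. *)
Lemma tame_cover f : f != 0 -> exists2 T, tame T &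
  forall P, irreducible_poly P -> row_inf P -> ~ free P -> P %| f -> P %| T.
Proof.
have [N] := ubnP (size f); elim: N f => // N IHN f le_f f0.
have [sf|sf] := leqP (size f) 1.
  exists 1; first exact: tame1.
  by move=> P irP _ _ /(dvdp_leq f0); have := irr_size irP; lia.
have [P irP Pf] := irr_factor sf.
have [c [g [c0 e g0 lt]]] := dvd_quotient f0 irP Pf.
have [|T tT HT] := IHN g _ g0; first exact: leq_trans lt _.
have [[rP nfP]|nP] := classic (row_inf P /\ ~ free P).
  exists (T * P); first by apply: tameM => //; apply: tame_nonfree.
  move=> Q irQ rQ nfQ; rewrite -(dvdpZr _ _ c0) e => /(irr_dvdM irQ)[/HT h|h].
    by apply: dvdp_mulr; apply: h.
  exact: dvdp_mull.
exists T => // Q irQ rQ nfQ; rewrite -(dvdpZr _ _ c0) e => /(irr_dvdM irQ)[/HT h|h].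
  exact: h.
have h' := irr_dvd_eqp irQ irP h.
case: nP; split=> [j hj|fP].
  by apply: rQ; apply: dvdp_trans h _; apply: dvdp_trans hj _; rewrite dvd_S.
apply: nfQ => i j hij; apply: fP.
by apply: dvdp_trans h' _; apply: dvdp_trans hij _; rewrite dvd_S.
Qed.

(** Every irreducible factor of the denominator must divide the numerator, so cancelling reduces the
    denominator to an element of [R]. *)
Lemma reg_everywhere z : (forall P, irreducible_poly P -> reg P z) ->
  exists c n, c != 0 /\ z * phi c%:P = phi n.
Proof.
move=> rz; have [n [d [d0 ez]]] := phi_frac z.
have {ez} : z * phi d = phi n by rewrite ez mulfVK // phi_neq0.
have [N] := ubnP (size d); elim: N d d0 n => // N IHN d d0 n le_d e.
have [sd|sd] := leqP (size d) 1.
  have ed := size1_polyC sd; exists d`_0, n; rewrite -ed; split=> //.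
  by apply: contraNneq d0 => z0; rewrite ed z0.
have [P irP Pd] := irr_factor sd.
have Pn : P %| n by apply: contraT => Pn; case: (pole_frac irP e Pd Pn); apply: rz.
have [c [g [c0 eg g0 lt]]] := dvd_quotient d0 irP Pd.
have [c' [g' [c'0 eg']]] := pdvdP _ _ Pn.
apply: (IHN (c' *: g) _ (c *: g')).
- by rewrite -mul_polyC mulf_neq0 ?polyC_eq0.
- by rewrite size_scale //; apply: leq_trans lt _.
- have P0 : phi P != 0 by rewrite phi_neq0 // irredp_neq0.
  apply: (mulIf P0); rewrite -mulrA -!rmorphM -!scalerAl -eg -eg' !scalerA (mulrC c').
  by rewrite -!mul_polyC [phi (_ * d)]rmorphM mulrCA e -rmorphM.
Qed.

(** * Existence of a telescoper *)

Hypothesis S0C : forall j c, S 0 j c%:P = c%:P.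
Variable kappa : R.
Hypothesis coef_S01 : forall f (m : nat), (S 0 1 f)`_m = kappa ^+ m * f`_m.
Hypothesis kappa_inj : injective (GRing.exp kappa).

Lemma kappa_neq0 : kappa != 0.
Proof. by apply/eqP => k0; have := @kappa_inj 1%N 2%N; rewrite k0 !expr0n => /(_ erefl). Qed.

Lemma coef_S0 f (t m : nat) : (S 0 t f)`_m = kappa ^+ (t * m) * f`_m.
Proof.
elim: t => [|t IHt]; first by rewrite S00 mul0n mul1r.
have -> : S 0 t.+1 f = S 0 1 (S 0 t f) by rewrite SS addr0 -intS.
by rewrite coef_S01 IHt mulrA -exprD mulSn.
Qed.

(** If [P] is associate to [S 0 t P], comparing coefficients gives one and the same value of
    [kappa ^+ (t * m)] for all [m] with nonzero coefficient; powers of [kappa] being distinct, [P]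
    is a monomial. *)
Lemma dvd_X_or_row_inf P : irreducible_poly P -> P %| 'X \/ row_inf P.
Proof.
move=> irP; have P0 := irredp_neq0 irP.
have [|nrP] := classic (row_inf P); [by right|left].
have [t t0 h] : exists2 t : nat, (0 < t)%N & P %| S 0 t P.
  apply: NNPP => nex; apply: nrP => j h.
  have h' : P %| S 0 (- j) P.
    have := SKV 0 j P; rewrite oppr0 -(dvd_S 0 j) => ->; exact: irr_dvd_eqp irP (irr_S 0 j irP) h.
  have [j0|j0|//] := Order.TotalTheory.ltgtP j 0; case: nex; exists (absz j); try lia.
    by rewrite (_ : Posz _ = - j) //; lia.
  by rewrite (_ : Posz _ = j) //; lia.
have : P %= S 0 t P by rewrite -dvdp_size_eqp // size_S.
move=> /Pdiv.Idomain.eqpP[[c c'] /= /andP[c0 c'0] e].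
have co m : P`_m != 0 -> c = c' * kappa ^+ (t * m).
  move=> Pm; have := congr1 (fun p : {poly R} => p`_m) e; rewrite !coefZ coef_S0 mulrA.
  exact: mulIf.
have Plead : P`_(size P).-1 != 0 by have := lead_coef_eq0 P; rewrite lead_coefE (negPf P0) => ->.
have mono m : m != (size P).-1 -> P`_m = 0.
  move=> ne; apply/eqP; apply: contraNT ne => Pm; apply/eqP.
  have /(mulfI c'0)/kappa_inj/eqP : c' * kappa ^+ (t * m) = c' * kappa ^+ (t * (size P).-1).
    by rewrite -co // -co.
  by rewrite eqn_pmul2l // => /eqP.
have eP : P = P`_(size P).-1 *: 'X^((size P).-1).
  apply/polyP => m; rewrite coefZ coefXn.
  by have [->|/mono->] := eqVneq; rewrite ?mulr1 ?mulr0.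
have : P %| 'X ^+ (size P).-1.
  by rewrite -(dvdpZr _ _ Plead) -eP.
by apply: contraTT => nX; apply: irr_ndvdX.
Qed.

(** Comparing leading coefficients determines [kappa] to the power of the degree of a solution,
    hence the degree. *)
Lemma kernel_size f g b b' : f != 0 -> b != 0 -> b' != 0 ->
  f * S 0 1 b = g * b -> f * S 0 1 b' = g * b' -> size b = size b'.
Proof.
move=> f0 b0 b'0 e e'.
have lc (x : {poly R}) : x != 0 -> f * S 0 1 x = g * x ->
    lead_coef f * kappa ^+ (size x).-1 = lead_coef g.
  move=> x0 ex; have lx0 : lead_coef x != 0 by rewrite lead_coef_eq0.
  apply: (mulIf lx0); rewrite -mulrA [kappa ^+ _ * _](_ : _ = lead_coef (S 0 1 x)).
    by rewrite -!lead_coefM ex.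
  by rewrite !lead_coefE size_S coef_S01.
have := lc b' b'0 e'; rewrite -(lc b b0 e) => /mulfI.
rewrite lead_coef_eq0 => /(_ f0)/kappa_inj.
by move: b0 b'0; rewrite -!size_poly_gt0; case: (size b) (size b') => [|x] [|y] //= _ _ ->.
Qed.

Lemma irr_X : irreducible_poly ('X : {poly R}).
Proof. by have := irredp_XsubC (0 : R); rewrite polyC0 subr0. Qed.

Lemma X_pole z : exists e : nat, forall P, irreducible_poly P -> P %| 'X ->
  reg P (phi 'X ^+ e * z).
Proof.
have [n [d [d0 ez]]] := phi_frac z.
have [k [c [d' [c0 e nX d'0 _]]]] := irr_extract irr_X d0.
exists k => P irP PX; exists (c *: n), d'; split.
  apply: contra nX => Pd'; apply: dvdp_trans Pd'; exact: irr_dvd_eqp irP irr_X PX.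
have pd0 := phi_neq0 d0.
have ec : phi c%:P * phi d = phi 'X ^+ k * phi d' by rewrite -rmorphXn -!rmorphM mul_polyC e.
by rewrite mulrAC -ec ez -mul_polyC rmorphM; field.
Qed.

(** Poles along y escape the row arguments. The exponent depends on [I], which is harmless: scaling
    y changes a power of y only by a constant. *)
Lemma X_pole_uniform (A : nat -> E) (I : nat) : exists e : nat, forall m, (m <= I)%N ->
  forall P, irreducible_poly P -> P %| 'X -> reg P (phi 'X ^+ e * A m).
Proof.
have mono e e' z P : (e <= e')%N -> irreducible_poly P -> reg P (phi 'X ^+ e * z) ->
    reg P (phi 'X ^+ e' * z).
  move=> le irP rz; rewrite -(subnK le) exprD -mulrA; apply: regM => //.
  by rewrite -rmorphXn; apply: reg_phi.
elim: I => [|I [e He]].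
  have [e He] := X_pole (A 0%N); exists e => m; rewrite leqn0 => /eqP->; exact: He.
have [e' He'] := X_pole (A I.+1); exists (e + e')%N => m; rewrite leq_eqVlt.
move=> /orP[/eqP->|le_m] P irP PX.
  by apply: (mono e'); rewrite ?leq_addl //; apply: He'.
by apply: (mono e); rewrite ?leq_addr //; apply: He.
Qed.

Lemma reg_everywhere_uniform (A : nat -> E) (I : nat) :
  (forall m, (m <= I)%N -> forall P, irreducible_poly P -> reg P (A m)) ->
  exists2 c, c != 0 & forall m, (m <= I)%N -> exists n, A m * phi c%:P = phi n.
Proof.
move=> rA; elim: I rA => [|I IHI] rA.
  have [c [n [c0 e]]] := reg_everywhere (rA 0%N isT).
  by exists c => // m; rewrite leqn0 => /eqP->; exists n.
have [m le_m|c c0 Hc] := IHI; first by apply: rA; apply: leqW.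
have [c' [n' [c'0 e']]] := reg_everywhere (rA I.+1 (leqnn _)).
exists (c * c'); first exact: mulf_neq0.
move=> m; rewrite leq_eqVlt polyCM rmorphM => /orP[/eqP->|/Hc[n e]].
  by exists (n' * c%:P); rewrite rmorphM -e' mulrCA mulrC.
by exists (n * c'%:P); rewrite rmorphM -e mulrA.
Qed.

(** By commutation the shift product solves a first-order equation in y whose coefficients come from
    [r2], [d2] and their x-shifts. Shifting preserves size, so the bound does not depend on [m]. *)
Lemma shift_prod_pole_bound r1 d1 r2 d2 P m : d1 != 0 -> r2 != 0 -> d2 != 0 ->
  sg 0 1 (phi r1 / phi d1) * (phi r2 / phi d2) =
    sg 1 0 (phi r2 / phi d2) * (phi r1 / phi d1) ->
  irreducible_poly P -> row_inf P ->
  reg P (phi P ^+ (size d2 + size r2) * shift_prod (phi r1 / phi d1) m).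
Proof.
move=> d10 r20 d20 e irP rP; set z := shift_prod _ _.
have sd0 : S m 0 d2 != 0 by rewrite S_eq0.
have eq : sg 0 1 z * phi (S m 0 d2 * r2) = phi (S m 0 r2 * d2) * z.
  have := shift_prod_comm m e; rewrite -/z fmorph_div !sg_phi => ez.
  have p0 := (phi_neq0 d20, phi_neq0 sd0).
  rewrite !rmorphM; transitivity (sg 0 1 z * (phi r2 / phi d2) * (phi (S m 0 d2) * phi d2)).
    by field; rewrite p0.
  by rewrite ez; field; rewrite p0.
have := pole_bound irP rP (mulf_neq0 sd0 r20) eq.
have le : (size (S m 0 d2 * r2)%R <= size d2 + size r2)%N by apply: size_mul_le; rewrite ?size_S.
rewrite -(subnK le) exprD -mulrA => rz; apply: regM => //.
by rewrite -rmorphXn; apply: reg_phi.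
Qed.

Lemma size_exp_le f D m : (size f <= D)%N -> (size (f ^+ m)%R <= D * m + 1)%N.
Proof.
move=> h; apply: leq_trans (size_poly_exp_leq _ _) _; rewrite addn1 ltnS leq_mul2r.
by apply/orP; right; apply: leq_trans h; apply: leq_pred.
Qed.

(** In [W] a power of y clears the poles along y, [u] the free ones, and [V ^+ C] the nonfree ones,
    which [tame_cover] locates and [shift_prod_pole_bound] bounds in order by [C]. *)
Lemma bounded_denominators r1 d1 r2 d2 u :
  r1 != 0 -> d1 != 0 -> r2 != 0 -> d2 != 0 -> u != 0 ->
  sg 0 1 (phi r1 / phi d1) * (phi r2 / phi d2) =
    sg 1 0 (phi r2 / phi d2) * (phi r1 / phi d1) ->
  (forall P m, irreducible_poly P -> free P ->
     reg P (phi u * shift_prod (phi r1 / phi d1) m)) ->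
  exists D : nat, forall I : nat, exists (V al be : {poly R}) (c : R),
    [/\ V != 0 /\ c != 0, al != 0 /\ be != 0, (size al <= D)%N /\ (size be <= D)%N,
        V * be = S 0 1 V * al
      & forall m, (m <= I)%N -> exists n,
          phi V * shift_prod (phi r1 / phi d1) m * phi c%:P = phi n].
Proof.
move=> r10 d10 r20 d20 u0 e ufree; set A := shift_prod _.
have [T [D0 tT] covT] := tame_cover d10.
pose C := (size d2 + size r2)%N.
exists (size u + (D0 * C + 1))%N => I.
have [V [al [be [V0 [al0 be0] [sal sbe] eV dV]]]] := tT I.
have [ex Xreg] := X_pole_uniform A I.
pose W := 'X^ex * u * V ^+ C.
have X0 : 'X^ex != 0 :> {poly R} by rewrite expf_neq0 // polyX_eq0.
have W0 : W != 0 by apply: mulf_neq0; [apply: mulf_neq0|apply: expf_neq0].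
have k0 := expf_neq0 ex kappa_neq0.
have Wreg m : (m <= I)%N -> forall P, irreducible_poly P -> reg P (phi W * A m).
  move=> le_m P irP; have [PX|rP] := dvd_X_or_row_inf irP.
    rewrite (_ : _ * A m = phi (u * V ^+ C) * (phi 'X ^+ ex * A m)); last first.
      by rewrite !rmorphM rmorphXn; ring.
    by apply: regM => //; [apply: reg_phi|apply: Xreg].
  have [fP|nfP] := classic (free P).
    rewrite (_ : _ * A m = phi ('X^ex * V ^+ C) * (phi u * A m)); last by rewrite !rmorphM; ring.
    by apply: regM => //; [apply: reg_phi|apply: ufree].
  rewrite (_ : _ * A m = phi ('X^ex * u) * (phi V ^+ C * A m)); last by rewrite !rmorphM !rmorphXn; ring.
  apply: regM => //; first exact: reg_phi.
  (* A pole of the product can only come from a shift of [d1]; if [P] divides one, then [P] divides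
     [V]. *)
  have [[j /andP[lt_j Pj]]|nP] := classic (exists j : nat, (j < m)%N && (P %| S j 0 d1)); last first.
    apply: regM => //; first by rewrite -rmorphXn; apply: reg_phi.
    apply: reg_prod => // j; rewrite fmorph_div !sg_phi; apply: reg_frac => //.
    by apply/negP => Pj; apply: nP; exists j; rewrite ltn_ord.
  have PV : P %| V.
    apply: dvdp_trans (dV j _); last by apply: leq_trans le_m; apply: ltnW.
    rewrite -[P](SKV j 0) dvd_S; apply: covT; rewrite ?dvd_Sl ?opprK ?oppr0 //.
    - exact: irr_S.
    - exact: row_inf_S.
    - by move=> /(@free_S j 0); rewrite SKV.
  have [c [g [c0 eg]]] := pdvdP _ _ PV.
  have pc0 : phi c%:P != 0 by rewrite phi_neq0 ?polyC_eq0.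
  have eg' : phi V = (phi c%:P)^-1 * phi g * phi P.
    by rewrite -mulrA -rmorphM -eg -mul_polyC rmorphM mulKf.
  rewrite eg' exprMn -mulrA; apply: regM => //; last exact: shift_prod_pole_bound.
  rewrite exprMn; apply: regM => //; last by rewrite -rmorphXn; apply: reg_phi.
  by rewrite exprVn -rmorphXn; apply/reg_inv/irr_ndvdX => //; apply: irr_ndvdC.
have [c c0 Hc] := reg_everywhere_uniform Wreg.
have S0 : S 0 1 u != 0 by rewrite S_eq0.
(* The power of y enters the ratio only through the scalar [kappa ^+ ex], so the sizes do not depend
   on [I]. *)
exists W, (u * al ^+ C), (kappa ^+ ex *: (S 0 1 u * be ^+ C)), c; split=> //.
- by rewrite -mul_polyC !mulf_neq0 ?expf_neq0 ?polyC_eq0.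
- by rewrite size_scale //; split; apply: size_mul_le; rewrite ?size_S ?size_exp_le.
- have SX : S 0 1 'X^ex = (kappa ^+ ex)%:P * 'X^ex.
    apply/polyP => m; rewrite coef_S01 mul_polyC coefZ coefXn.
    by case: eqP => [->|]; rewrite ?mulr0.
  have -> : S 0 1 W = (kappa ^+ ex)%:P * 'X^ex * S 0 1 u * S 0 1 V ^+ C.
    by rewrite 2!rmorphM SX [S 0 1 (V ^+ C)]rmorphXn.
  rewrite -mul_polyC /W; move: (kappa ^+ ex)%:P 'X^ex (S 0 1 u) => kp x su.
  transitivity (kp * x * u * su * (V * be) ^+ C); first by rewrite exprMn; ring.
  by rewrite eV exprMn; ring.
Qed.

(* Leaving out the monomial ['X^e] of the only possible degree of a solution of
   [rho * S 0 1 b = tau * b] keeps the coefficients [a] from vanishing. *)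
Lemma exists_telescoper r1 d1 r2 d2 u :
  r1 != 0 -> d1 != 0 -> r2 != 0 -> d2 != 0 -> u != 0 ->
  sg 0 1 (phi r1 / phi d1) * (phi r2 / phi d2) =
    sg 1 0 (phi r2 / phi d2) * (phi r1 / phi d1) ->
  (forall P m, irreducible_poly P -> free P ->
     reg P (phi u * shift_prod (phi r1 / phi d1) m)) ->
  exists (I : nat) (a : 'I_I.+1 -> R) (g : E), (exists x, a x != 0) /\
    \sum_(i < I.+1) phi (a i)%:P * shift_prod (phi r1 / phi d1) i =
      phi r2 / phi d2 * sg 0 1 g - g.
Proof.
move=> r10 d10 r20 d20 u0 comm ufree; set A := shift_prod _.
have [D HD] := bounded_denominators r10 d10 r20 d20 u0 comm ufree.
(* The order is chosen to dominate the sizes of [rho] and [tau] below, which are bounded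
   independently of it. *)
pose I := (D + (size r2 + size d2))%N.
have [V [al [be [c [[V0 c0] [al0 be0] [sal sbe] eV HB]]]]] := HD I.
have /fin_all_exists[B eB] (i : 'I_I.+1) : exists n, phi V * A i * phi c%:P = phi n.
  by apply: HB; rewrite -ltnS ltn_ord.
(* With [g = tau * b / (c * V)], multiplying the telescoping equation by [c * V] leaves the
   polynomial equation [\sum a i *: B i = rho * S 0 1 b - tau * b]. The shift by -1 makes [sg 0 1]
   turn [tau] into [d2 * be], which cancels the denominators. *)
pose rho := r2 * al; pose tau := S 0 (-1) (d2 * be).
have rho0 : rho != 0 by apply: mulf_neq0.
have srho : (size rho <= I)%N.
  apply: leq_trans (size_mul_le (leqnn _) sal) _; rewrite /I; clear; lia.
have stau : (size tau <= I)%N.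
  rewrite size_S; apply: leq_trans (size_mul_le (leqnn _) sbe) _; rewrite /I; clear; lia.
(* All nonzero homogeneous solutions share one size by [kernel_size]; if there are none, 0
   serves. *)
have [e He] : exists e : nat, forall b, b != 0 -> rho * S 0 1 b = tau * b -> size b = e.+1.
  have [[b0 b0P]|nex] := classic (exists b0, b0 != 0 /\ rho * S 0 1 b0 = tau * b0); last first.
    by exists 0%N => b b0 eb; case: nex; exists b.
  have [b00 eb0] := b0P; exists (size b0).-1 => b b1 eb.
  rewrite prednK ?size_poly_gt0 //; exact: kernel_size eb eb0.
pose N0 := \max_(i < I.+1) size (B i).
(* [bump e] enumerates the exponents other than [e]. *)
pose mono (j : nat) : {poly R} := 'X^(bump e j).
pose F (j : nat) := rho * S 0 1 (mono j) - tau * mono j.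
pose f (i : 'I_(I.+1 + (N0 + e))) := match split i with inl k => B k | inr j => F j end.
have smono (j : 'I_(N0 + e)) : (size (mono j) <= (N0 + e).+1)%N.
  rewrite size_polyXn ltnS /bump; have := ltn_ord j; clear; case: (e <= j)%N; lia.
have szM (x y : {poly R}) : (size x <= I)%N -> (size y <= (N0 + e).+1)%N ->
    (size (x * y)%R <= I + (N0 + e))%N.
  by move=> h h'; have := size_polyMleq x y; clear -h h'; lia.
(* There is one unknown more than the common size bound [I + (N0 + e)]. *)
have [||x [[i0 xi0] sum0]] := @poly_lin_dep _ (I + (N0 + e)) _ f.
- by rewrite addSn.
- move=> i; rewrite /f; case: (split i) => [k|j].
    apply: leq_trans (_ : (N0 <= _)%N); last by clear; lia.
    exact: (@leq_bigmax _ (fun i : 'I_I.+1 => size (B i))).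
  rewrite /F; apply: leq_trans (size_polyD _ _) _; rewrite geq_max size_polyN.
  by rewrite !szM // size_S.
pose a (i : 'I_I.+1) := x (lshift (N0 + e) i); pose y (j : 'I_(N0 + e)) := x (rshift I.+1 j).
have {}sum0 : \sum_(i < I.+1) a i *: B i + \sum_(j < N0 + e) y j *: F j = 0.
  rewrite -[RHS]sum0 [RHS]big_split_ord /=; congr (_ + _); apply: eq_bigr => i _.
    by rewrite /f (unsplitK (inl i)).
  by rewrite /f (unsplitK (inr i)).
pose b := - \sum_(j < N0 + e) y j *: mono j.
have eb : \sum_(i < I.+1) a i *: B i = rho * S 0 1 b - tau * b.
  apply/eqP; rewrite -subr_eq0; apply/eqP; rewrite -[RHS]sum0; congr (_ + _).
  rewrite /b rmorphN rmorph_sum /= !mulrN opprD !opprK !mulr_sumr -sumrB.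
  apply: eq_bigr => j _; rewrite -!mul_polyC rmorphM S0C /F; ring.
have a_neq0 : exists x, a x != 0.
  apply: NNPP => nex.
  have ker : rho * S 0 1 b = tau * b.
    apply/eqP; rewrite -subr_eq0 -eb big1 // => i _.
    have /eqP-> : a i == 0 by apply: contraT => ai; case: nex; exists i.
    by rewrite scale0r.
  have coefb m : b`_m = - \sum_(j < N0 + e) y j * (m == bump e j)%:R.
    rewrite coefN coef_sum; congr (- _); apply: eq_bigr => j _.
    by rewrite coefZ coefXn.
  have be' : b`_e = 0.
    by rewrite coefb big1 ?oppr0 // => j _; rewrite (negPf (neq_bump _ _)) mulr0.
  have [j yj] : exists x, y x != 0.
    case: (splitP i0) => [k ek|j ej].
      by case: nex; exists k; rewrite /a (_ : lshift _ k = i0) //; apply: val_inj.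
    by exists j; rewrite /y (_ : rshift _ j = i0) //; apply: val_inj.
  have b0 : b != 0.
    apply: contraNneq yj => b0; have := coefb (bump e j).
    rewrite b0 coef0 (bigD1 j) //= eqxx mulr1 big1 ?addr0 => [/eqP|k kj].
      by rewrite eq_sym oppr_eq0.
    by rewrite (can_eq (bumpK e)) eq_sym (negPf (kj : nat_of_ord k != nat_of_ord j)) mulr0.
  have := lead_coef_eq0 b; rewrite lead_coefE (He _ b0 ker) be' eqxx => /esym/eqP.
  by apply/eqP.
exists I, a, (phi (tau * b) / (phi c%:P * phi V)); split=> //.
have pc0 : phi c%:P != 0 by rewrite phi_neq0 ?polyC_eq0.
have pV0 := phi_neq0 V0; have pd0 := phi_neq0 d20; have pbe0 := phi_neq0 be0.
have sV0 : phi (S 0 1 V) != 0 by rewrite phi_neq0 ?S_eq0.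
apply: (mulIf (mulf_neq0 pc0 pV0)).
transitivity (phi (\sum_(i < I.+1) a i *: B i)).
  rewrite rmorph_sum mulr_suml; apply: eq_bigr => i _ /=.
  by rewrite -mul_polyC rmorphM -eB; ring.
have sgtau : S 0 1 tau = d2 * be by rewrite /tau SS addr0 subrr S00.
rewrite eb fmorph_div rmorphM !sg_phi S0C !rmorphM rmorphB !rmorphM sgtau rmorphM.
have eV' : phi be = phi (S 0 1 V) * phi al / phi V by rewrite -rmorphM -eV rmorphM mulrAC mulfV ?mul1r.
rewrite eV'; field; by rewrite pc0 pV0 pd0 sV0.
Qed.

(** * The two implications for certificates *)

Lemma shift_prodM z w m : shift_prod (z * w) m = shift_prod z m * shift_prod w m.
Proof. by rewrite /shift_prod -big_split; apply: eq_bigr => i _; rewrite rmorphM. Qed.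

(** The correction factors [w / sg 1 0 w] telescope to [w / sg m 0 w]. *)
Lemma shift_prod_normal z w m : w != 0 ->
  shift_prod (z * (w / sg 1 0 w)) m * sg m 0 w = shift_prod z m * w.
Proof.
move=> w0; rewrite shift_prodM -mulrA; congr (_ * _).
elim: m => [|m IHm]; first by rewrite /shift_prod big_ord0 mul1r sg00.
rewrite shift_prodS fmorph_div sgsg addr0 -PoszD addn1.
by rewrite mulrA mulfVK ?fmorph_eq0.
Qed.

(** [h] and [z * (w / sg 1 0 w)] are the certificates of T / w; their compatibility is inherited
    from T. *)
Lemma normal_comm z w h : w != 0 ->
  sg 0 1 z * (h * (sg 0 1 w / w)) = sg 1 0 (h * (sg 0 1 w / w)) * z ->
  sg 0 1 (z * (w / sg 1 0 w)) * h = sg 1 0 h * (z * (w / sg 1 0 w)).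
Proof.
move=> w0 e; rewrite !rmorphM !fmorphV in e *.
have n0 i j : sg i j w != 0 by rewrite fmorph_eq0.
rewrite (sgC 1 0 0 1) in e.
have n1 : sg 0 1 (sg 1 0 w) != 0 by rewrite !fmorph_eq0.
have -> : sg 0 1 z * (sg 0 1 w / sg 0 1 (sg 1 0 w)) * h =
    sg 0 1 z * (h * (sg 0 1 w / w)) * (w / sg 0 1 (sg 1 0 w)).
  by field; rewrite n1 w0.
by rewrite e; field; rewrite n1 n0.
Qed.

Section NormalForm.
Variables (r t u v : {poly R}) (R1 : E).
Hypotheses (r0 : r != 0) (t0 : t != 0) (u0 : u != 0) (v0 : v != 0) (R10 : R1 != 0).
Hypothesis rt : row_coprime r t.
Let w := phi u / phi v.
Let R2 := phi r / phi t * (sg 0 1 w / w).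
Hypothesis comm : sg 0 1 R1 * R2 = sg 1 0 R2 * R1.

Let w0 : w != 0.
Proof. by rewrite mulf_neq0 ?invr_eq0 ?phi_neq0. Qed.

(** Multiplying the equation by [w] replaces R2 by [phi r / phi t] and [g] by [w * g], the shape
    treated by [telescoper_no_free]. *)
Lemma free_ndvd_of_telescoper (g : E) (a : nat -> R) (I : nat) P :
  (forall P, irreducible_poly P -> P %| v -> ~~ (P %| u)) ->
  (forall P m, irreducible_poly P -> P %| v -> P %| S 0 m v -> m = 0) ->
  a I != 0 ->
  \sum_(i < I.+1) phi (a i)%:P * shift_prod R1 i = R2 * sg 0 1 g - g ->
  irreducible_poly P -> free P -> ~~ (P %| v).
Proof.
move=> uv eps aI e.
have f0 : R1 * (w / sg 1 0 w) != 0 by rewrite !mulf_neq0 ?invr_eq0 ?fmorph_eq0 ?phi_neq0.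
apply: (telescoper_no_free r0 t0 f0 v0 rt (normal_comm w0 comm) uv eps aI (g := w * g)).
transitivity ((\sum_(i < I.+1) phi (a i)%:P * shift_prod R1 i) * w).
  by rewrite mulr_suml; apply: eq_bigr => i _; rewrite -mulrA shift_prod_normal // mulrA.
rewrite e rmorphM /R2; move: (phi r / phi t) (sg 0 1 w) (sg 0 1 g) => x y z.
by field.
Qed.

(** The shift product of [R1] is that of the normalised certificate times [sg m 0 w / w]. At a free
    [P] the former is regular, [u] clears [1 / w], and the shifts of [v] have no free factor. *)
Lemma telescoper_of_nonfree :
  (forall P, irreducible_poly P -> P %| v -> ~ free P) ->
  exists (I : nat) (a : 'I_I.+1 -> R) (g : E), (exists x, a x != 0) /\
    \sum_(i < I.+1) phi (a i)%:P * shift_prod R1 i = R2 * sg 0 1 g - g.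
Proof.
move=> nfv.
have R20 : R2 != 0 by rewrite !mulf_neq0 ?invr_eq0 ?fmorph_eq0 ?phi_neq0.
have [r1 [d1 [d10 e1]]] := phi_frac R1; have [r2 [d2 [d20 e2]]] := phi_frac R2.
have num0 (x y : {poly R}) z : z = phi x / phi y -> z != 0 -> x != 0.
  by move=> ez; apply: contraNneq => x0; rewrite ez x0 rmorph0 mul0r.
have r10 := num0 _ _ _ e1 R10; have r20 := num0 _ _ _ e2 R20.
rewrite e1 e2; apply: (exists_telescoper r10 d10 r20 d20 u0).
  by rewrite -e1 -e2.
move=> P m irP fP; rewrite -e1.
have f0 : R1 * (w / sg 1 0 w) != 0 by rewrite !mulf_neq0 ?invr_eq0 ?fmorph_eq0 ?phi_neq0.
have [rf _] := free_reg_shift_prod m r0 t0 f0 rt (normal_comm w0 comm) irP fP.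
have -> : phi u * shift_prod R1 m =
    shift_prod (R1 * (w / sg 1 0 w)) m * phi v * (phi (S m 0 u) / phi (S m 0 v)).
  have <- : sg m 0 w = phi (S m 0 u) / phi (S m 0 v) by rewrite /w fmorph_div !sg_phi.
  rewrite mulrAC shift_prod_normal // /w.
  have := phi_neq0 v0; move: (phi u) (phi v) (shift_prod R1 m) => x y z y0.
  by field.
apply: regM => //; first by apply: regM => //; apply: reg_phi.
apply: reg_frac => //; apply/negP => h.
have /nfv : irreducible_poly (S (- m%:Z) 0 P) by apply: irr_S.
rewrite dvd_Sl opprK oppr0 h => /(_ isT); apply; exact: free_S.
Qed.

End NormalForm.

End Core.

(** * Automorphisms of fraction fields and the scalings of F(x, y) *)

Section FractionMap.
Variable R : idomainType.
Implicit Types (n d p : R) (z : {fraction R}).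
Import FracField.

Lemma fraction_exists z : exists nd : R * R,
  (nd.2 != 0) && (z == tofrac nd.1 / tofrac nd.2).
Proof.
elim/quotW: z => x; exists (\n_x, \d_x) => /=; rewrite denom_ratioP /=.
have d0 : tofrac \d_x != 0 by rewrite tofrac_eq0 denom_ratioP.
apply/eqP/(mulIf d0); rewrite mulfVK //; unlock tofrac; rewrite -[LHS]pi_mul.
apply/eqmodP; rewrite /= equivfE /mulf !numden_Ratio ?(oner_eq0, mulf_neq0, denom_ratioP) //.
by rewrite !mulr1 mulrC.
Qed.

(** Computed on a chosen representative; [frac_mapE] shows that the choice does not matter when [f]
    has trivial kernel. *)
Definition frac_map (f : R -> R) z : {fraction R} :=
  let nd := xchoose (fraction_exists z) in tofrac (f nd.1) / tofrac (f nd.2).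

Variable f : {rmorphism R -> R}.
Hypothesis f_eq0 : forall p, (f p == 0) = (p == 0).

Lemma frac_mapE n d : d != 0 ->
  frac_map f (tofrac n / tofrac d) = tofrac (f n) / tofrac (f d).
Proof.
move=> d0; rewrite /frac_map; case: (xchooseP (fraction_exists (tofrac n / tofrac d))).
move: (xchoose _) => [n' d'] /= /andP[d'0 /eqP/esym/eqP].
rewrite !GRing.eqr_div ?tofrac_eq0 // -!tofracM tofrac_eq => /eqP e.
apply/eqP; rewrite GRing.eqr_div ?tofrac_eq0 ?f_eq0 // -!tofracM -!rmorphM.
by rewrite e.
Qed.

Lemma frac_map_tofrac n : frac_map f (tofrac n) = tofrac (f n).
Proof.
have := @frac_mapE n 1; rewrite rmorph1 !tofrac1 !divr1; apply.
exact: oner_neq0.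
Qed.

Lemma fracP z : exists n d, d != 0 /\ z = tofrac n / tofrac d.
Proof.
by have [[n d] /= /andP[d0 /eqP->]] := fraction_exists z; exists n, d.
Qed.

Lemma frac_map_zmod : zmod_morphism (frac_map f).
Proof.
move=> x y; have [n [d [d0 ->]]] := fracP x; have [n' [d' [d'0 ->]]] := fracP y.
have td : tofrac d != 0 by rewrite tofrac_eq0.
have td' : tofrac d' != 0 by rewrite tofrac_eq0.
rewrite -mulNr addf_div // -tofracN -!tofracM -tofracD !frac_mapE ?mulf_neq0 //.
rewrite -mulNr addf_div ?tofrac_eq0 ?f_eq0 // -tofracN -!tofracM -tofracD.
by rewrite rmorphD !rmorphM rmorphN.
Qed.

Lemma frac_map_monoid : monoid_morphism (frac_map f).
Proof.
split; first by rewrite -tofrac1 frac_map_tofrac rmorph1.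
move=> x y; have [n [d [d0 ->]]] := fracP x; have [n' [d' [d'0 ->]]] := fracP y.
by rewrite mulf_div -!tofracM !frac_mapE ?mulf_neq0 // mulf_div -!tofracM !rmorphM.
Qed.

Definition frac_morphism : {rmorphism {fraction R} -> {fraction R}} :=
  HB.pack_for {rmorphism {fraction R} -> {fraction R}} (frac_map f)
    (GRing.isZmodMorphism.Build _ _ (frac_map f) frac_map_zmod)
    (GRing.isMonoidMorphism.Build _ _ (frac_map f) frac_map_monoid).

End FractionMap.

Section QScale.
Variables (F : fieldType) (q : F).
Implicit Types (p f g : bipoly F) (i j : int).

Lemma coef_comp_scale (R : comNzRingType) (c : R) (p : {poly R}) m :
  (p \Po (c *: 'X))`_m = c ^+ m * p`_m.
Proof.
elim/poly_ind: p m => [|p b IHp] m; first by rewrite comp_poly0 !coef0 mulr0.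
rewrite comp_poly_MXaddC !coefD -scalerAr coefZ !coefMX !coefC.
by case: m => [|m] /=; rewrite ?mulr0 ?add0r ?mul1r // !addr0 IHp mulrA exprS.
Qed.

Lemma coef_qscale i j p m k :
  (qscale q i j p)`_m`_k = (q ^ j) ^+ m * ((q ^ i) ^+ k * p`_m`_k).
Proof.
by rewrite /qscale coef_comp_scale coef_map -rmorphXn coefCM coef_comp_scale.
Qed.

Lemma qscale_zmod i j : zmod_morphism (qscale q i j).
Proof. by move=> f g; rewrite /qscale rmorphB /= comp_polyB. Qed.

Lemma qscale_monoid i j : monoid_morphism (qscale q i j).
Proof.
split=> [|f g]; first by rewrite /qscale rmorph1 comp_polyC.
by rewrite /qscale rmorphM /= comp_polyM.
Qed.

HB.instance Definition _ i j :=
  GRing.isZmodMorphism.Build _ _ (qscale q i j) (qscale_zmod i j).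
HB.instance Definition _ i j :=
  GRing.isMonoidMorphism.Build _ _ (qscale q i j) (qscale_monoid i j).

Lemma eval2_qscale i j p a b :
  eval2 (qscale q i j p) a b = eval2 p (q ^ i * a) (q ^ j * b).
Proof.
rewrite /eval2 /qscale horner_comp hornerZ hornerX -polyCM.
rewrite -{1}[(_ * b)%:P](comp_polyC _ (q ^ i *: 'X)) horner_map /=.
by rewrite horner_comp hornerZ hornerX.
Qed.

Hypothesis q_neq0 : q != 0.

Lemma qscale00 p : qscale q 0 0 p = p.
Proof. by apply/polyP => m; apply/polyP => k; rewrite coef_qscale !expr1n !mul1r. Qed.

Lemma qscaleD i j k l p :
  qscale q i j (qscale q k l p) = qscale q (i + k) (j + l) p.
Proof.
apply/polyP => m; apply/polyP => n; rewrite !coef_qscale !expfzDr // !exprMn; ring.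
Qed.

Lemma size_qscale i j p : size (qscale q i j p) = size p.
Proof.
have le r i' j' : (size (qscale q i' j' r) <= size r)%N.
  apply/leq_sizeP => m le_m; apply/polyP => k.
  by rewrite coef_qscale (nth_default 0 le_m) !coef0 !mulr0.
apply/eqP; rewrite eqn_leq le /=.
by have := le (qscale q i j p) (- i) (- j); rewrite qscaleD !addNr qscale00.
Qed.

Lemma qscale_eq0 i j p : (qscale q i j p == 0) = (p == 0).
Proof. by rewrite -!size_poly_eq0 size_qscale. Qed.

Lemma qscale0C j (c : {poly F}) : qscale q 0 j c%:P = c%:P.
Proof.
apply/polyP => m; apply/polyP => k; rewrite coef_qscale expr1n mul1r coefC.
by case: m => [|m] /=; rewrite ?expr0 ?mul1r // coef0 mulr0.
Qed.

Lemma coef_qscale01 p m : (qscale q 0 1 p)`_m = q%:P ^+ m * p`_m.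
Proof.
by apply/polyP => k; rewrite coef_qscale expr1n mul1r -rmorphXn coefCM expr1z.
Qed.

Definition fscale i j : {rmorphism birat F -> birat F} :=
  frac_morphism (qscale_eq0 i j).

Lemma fscale_tofrac i j p : fscale i j (tofrac p) = tofrac (qscale q i j p).
Proof. exact/frac_map_tofrac/qscale_eq0. Qed.

End QScale.

(** * Gauss's lemma *)

Section Gauss.
Variable F : fieldType.
Implicit Types (p f g : bipoly F) (c : {poly F}).

Definition primitive p := forall pi : {poly F}, (1 < size pi)%N ->
  exists m, ~~ (pi %| p`_m).

(** Take the first coefficients of [f] and [g] not divisible by [pi], at [m] and [k]: in the
    coefficient of the product at [m + k], exactly one summand is not divisible by [pi]. *)
Lemma content_prime (pi : {poly F}) f g : irreducible_poly pi ->
  (forall m, pi %| (f * g)`_m) ->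
  (forall m, pi %| f`_m) \/ (forall m, pi %| g`_m).
Proof.
move=> irpi dfg; apply: NNPP => /not_or_and[/not_all_ex_not ef /not_all_ex_not eg].
have first (h : bipoly F) : (exists m, ~ pi %| h`_m) ->
    exists2 m, ~~ (pi %| h`_m) & forall k, (k < m)%N -> pi %| h`_k.
  move=> [m /negP hm]; have ex : exists m, ~~ (pi %| h`_m) by exists m.
  exists (ex_minn ex); case: ex_minnP => // n _ min k lt_k.
  by apply: contraTT lt_k => /min; rewrite -leqNgt.
have [m fm min_f] := first f ef; have [k gk min_g] := first g eg.
have := dfg (m + k)%N; rewrite coefM.
have lt_m : (m < (m + k).+1)%N by rewrite ltnS leq_addr.
rewrite (bigD1 (Ordinal lt_m)) //= dvdp_addl.
  by rewrite addKn; apply/negP/irr_ndvdM.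
elim/big_ind: _ => [|x y|i ne]; [exact: dvdp0|exact: dvdp_add|].
have [lt_i|gt_i|ei] := ltngtP i m; last by case/eqP: ne; apply: val_inj.
  by apply: dvdp_mulr; apply: min_f.
by apply: dvdp_mull; apply: min_g; have := ltn_ord i; lia.
Qed.

Lemma content_divide (pi : {poly F}) f : (forall m, pi %| f`_m) ->
  exists g, f = pi%:P * g.
Proof.
move=> h; exists (\poly_(m < size f) (f`_m %/ pi)); apply/polyP => m.
rewrite coefCM coef_poly; case: ltnP => [_|le]; first by rewrite mulrC divpK.
by rewrite mulr0 nth_default.
Qed.

(** Removing a common factor of the coefficients lowers the x-degree of the leading coefficient. *)
Lemma primitive_part f : f != 0 -> exists c p,
  [/\ c != 0, primitive p & f = c%:P * p].
Proof.
have [N] := ubnP (size (lead_coef f)); elim: N f => // N IHN f le_N f0.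
have [prim|] := classic (primitive f).
  by exists 1, f; rewrite oner_eq0 mul1r.
move=> /not_all_ex_not[pi npi]; have [spi /not_ex_all_not dpi] := imply_to_and _ _ npi.
have [m|g eg] := @content_divide pi f; first by apply: contraT => /dpi.
have pi0 : pi != 0 by rewrite -size_poly_gt0 ltnW.
have g0 : g != 0 by apply: contraNneq f0 => g0; rewrite eg g0 mulr0.
have [|c [p [c0 pp e]]] := IHN g _ g0.
  have lg0 : lead_coef g != 0 by rewrite lead_coef_eq0.
  move: le_N; rewrite eg lead_coefM lead_coefC size_mul //.
  move: lg0 spi; rewrite -size_poly_gt0; move: (size (lead_coef g)) (size pi) => x y.
  by clear; lia.
by exists (pi * c), p; split; rewrite ?mulf_neq0 // eg e polyCM mulrA.
Qed.

(** The bridge from divisibility in F(x)[y] to divisibility in F[x, y]: an irreducible factor of the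
    multiplier [c] divides all coefficients of [g * p], hence those of [g], and cancels. *)
Lemma primitive_dvd2 p f : primitive p -> p %| f -> dvd2 p f.
Proof.
move=> pp /pdvdP[c [g [c0 e]]].
have [N] := ubnP (size c); elim: N c g c0 e => // N IHN c g c0 e le_N.
have [sc|sc] := leqP (size c) 1.
  have ec := size1_polyC sc.
  have cc0 : c`_0 != 0 by apply: contraNneq c0 => z; rewrite ec z.
  exists ((c`_0)^-1%:P *: g); rewrite -scalerAl -e scalerA ec -polyCM coefC /= mulVf //.
  by rewrite scale1r.
have [pi irpi pic] := irr_factor sc.
have [|dg|dp] := @content_prime pi g p irpi.
- by move=> m; rewrite -e coefZ dvdp_mulr.
- have [g' eg'] := content_divide dg; have pi0 := irredp_neq0 irpi.
  have ec := divpK pic; have c'0 : c %/ pi != 0.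
    by apply: contraNneq c0 => z; rewrite -ec z mul0r.
  apply: (IHN (c %/ pi) g') => //.
    have piP0 : pi%:P != 0 :> bipoly F by rewrite polyC_eq0.
    by apply: (mulfI piP0); rewrite [RHS]mulrA -eg' -e -!mul_polyC mulrA -polyCM (mulrC pi) ec.
  move: le_N; rewrite -{1}ec size_mul //; move: (irr_size irpi) c'0; rewrite -size_poly_gt0.
  by move: (size (c %/ pi)) (size pi) => x y; clear; lia.
- have [m] := pp pi (irr_size irpi); by rewrite dp.
Qed.

Lemma irr_irreducible2 p : primitive p -> irreducible_poly p -> irreducible2 p.
Proof.
move=> pp irp; have p0 := irredp_neq0 irp; split=> //.
  rewrite poly_unitE negb_and; apply/orP; left.
  by rewrite neq_ltn irr_size ?orbT.
have cst (f g : bipoly F) : p = f * g -> size f = 1%N -> f \is a GRing.unit.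
  move=> e sf; have ef := size1_polyC (eq_leq sf).
  rewrite poly_unitE sf eqxx /=; apply: contraT => nu.
  have f0 : f`_0 != 0 by apply/eqP => z; move: sf; rewrite ef z size_poly0.
  have sf0 : (1 < size (f`_0)%R)%N.
    rewrite ltnNge; apply: contra nu => le1; rewrite poly_unitE eqn_leq le1 size_poly_gt0 f0 /=.
    rewrite unitfE; apply: contra f0 => /eqP z; apply/eqP.
    by rewrite (size1_polyC le1) z.
  have [m] := pp _ sf0; rewrite e ef coefCM coefC /= dvdp_mulr //; exact: dvdpp.
move=> f g e; have [sf|sf] := eqVneq (size f) 1%N; first by left; apply: (cst _ g).
right; apply: (cst _ f); first by rewrite e mulrC.
have /eqp_size szf : f %= p by apply: irp.2 => //; rewrite e dvdp_mulIl.
have : f * g != 0 by rewrite -e.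
rewrite mulf_eq0 negb_or => /andP[f0 g0].
move: (congr1 (fun x : bipoly F => size x) e); rewrite size_mul // -szf.
move: f0 g0; rewrite -!size_poly_gt0; move: (size f) (size g) => x y.
by clear; lia.
Qed.

(** A divisor over F(x) is replaced by its primitive part, which divides [p] in F[x, y], where
    irreducibility applies. *)
Lemma irreducible2_irr p : irreducible2 p -> (1 < size p)%N ->
  primitive p /\ irreducible_poly p.
Proof.
move=> [p0 nu irp] sp.
have unit1 (g : bipoly F) : g \is a GRing.unit -> size g = 1%N.
  by rewrite poly_unitE => /andP[/eqP].
have pp : primitive p.
  move=> pi spi; apply: NNPP => nex.
  have [m|g eg] := @content_divide pi p.
    by apply: contraT => h; case: nex; exists m.
  have [] := irp _ _ eg.
    rewrite poly_unitE coefC /= => /andP[_]; rewrite poly_unitE => /andP[/eqP s1].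
    by move: spi; rewrite s1.
  move/unit1 => s1; move: sp; rewrite eg mul_polyC size_scale ?s1 //.
  by rewrite -size_poly_gt0 ltnW.
split=> //; split=> // f sf fp; have f0 := dvdpN0 fp p0.
have [c [f' [c0 pf' ef]]] := primitive_part f0.
have ff' : f %= f' by rewrite ef mul_polyC eqp_scale.
have [g eg] : dvd2 f' p by apply: primitive_dvd2 => //; rewrite -(eqp_dvdl _ ff').
have [/unit1 ug|/unit1 uf] := irp _ _ eg; last by rewrite (eqp_size ff') uf in sf.
apply: eqp_trans ff' _; rewrite eg (size1_polyC (eq_leq ug)) mul_polyC eqp_sym eqp_scale //.
by apply/eqP => z; have := ug; rewrite (size1_polyC (eq_leq ug)) z size_poly0.
Qed.

Lemma irr_primitive_part P : irreducible_poly P ->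
  exists p, [/\ irreducible2 p, primitive p, P %| p & p %| P].
Proof.
move=> irP; have [c [p [c0 pp e]]] := primitive_part (irredp_neq0 irP).
have /andP[h1 h2] : P %= p by rewrite e mul_polyC eqp_scale.
exists p; split=> //; apply: irr_irreducible2 => //.
split; first by rewrite -(eqp_size (_ : P %= p)) ?irr_size // /eqp h1.
move=> f sf fp; apply: eqp_trans (_ : P %= p); last by rewrite /eqp h1.
by apply: irP.2 => //; apply: dvdp_trans h2.
Qed.

End Gauss.

(** * Values on the grid *)

Section Grid.
Variables (F : fieldType) (q : F).
Hypothesis q_neq0 : q != 0.
Hypothesis q_not_root1 : forall n : nat, (0 < n)%N -> q ^+ n != 1.
Implicit Types (p d f g : bipoly F) (z w : birat F) (a b c : F).

Lemma expq_inj : injective (GRing.exp q).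
Proof.
move=> m n; wlog le_mn : m n / (m <= n)%N.
  by move=> H e; case/orP: (leq_total m n) => h; [apply: H|symmetry; apply: H].
move=> e; apply/eqP; rewrite eqn_leq le_mn leqNgt; apply/negP; rewrite -subn_gt0 => lt.
case/eqP: (q_not_root1 lt); apply: (mulfI (expf_neq0 m q_neq0)).
by rewrite mulr1 -exprD subnKC.
Qed.

Lemma poly0_of_roots (R : idomainType) (x : nat -> R) (p : {poly R}) :
  injective x -> (forall m, p.[x m] = 0) -> p = 0.
Proof.
move=> injx px; apply/eqP; apply: contraT => p0.
have := max_poly_roots p0 (_ : all (root p) (mkseq x (size p))) _.
rewrite size_mkseq ltnn; apply.
  by apply/allP => _ /mapP[m _ ->]; rewrite /root px.
by rewrite mkseq_uniq.
Qed.

Definition grid f (n k : nat) := eval2 f (q ^+ n) (q ^+ k).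

Lemma grid0 f : (forall n k, grid f n k = 0) -> f = 0.
Proof.
move=> fg; apply: (@poly0_of_roots _ (fun k => (q ^+ k)%:P)).
  by move=> m n /polyC_inj/expq_inj.
move=> k; apply: (@poly0_of_roots _ (GRing.exp q)); first exact: expq_inj.
by move=> n; apply: fg.
Qed.

Lemma eval2M f g a b : eval2 (f * g) a b = eval2 f a b * eval2 g a b.
Proof. by rewrite /eval2 !hornerM. Qed.

Lemma eval2D f g a b : eval2 (f + g) a b = eval2 f a b + eval2 g a b.
Proof. by rewrite /eval2 !hornerD. Qed.

Lemma eval2N f a b : eval2 (- f) a b = - eval2 f a b.
Proof. by rewrite /eval2 !hornerN. Qed.

Lemma eval2_0 a b : eval2 0 a b = 0 :> F.
Proof. by rewrite /eval2 !horner0. Qed.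

Lemma eval2_1 a b : eval2 1 a b = 1 :> F.
Proof. by rewrite /eval2 !hornerE. Qed.

Lemma rat_value_tofrac f a b : rat_value (tofrac f) a b (eval2 f a b).
Proof.
exists f, 1; rewrite /is_frac tofrac1 divr1 !oner_eq0 eval2_1 oner_eq0.
by rewrite divr1.
Qed.

Lemma rat_valueM z w a b c c' : rat_value z a b c -> rat_value w a b c' ->
  rat_value (z * w) a b (c * c').
Proof.
move=> [n [d [[d0 ->] dab ->]]] [n' [d' [[d'0 ->] d'ab ->]]].
exists (n * n'), (d * d'); rewrite !eval2M mulf_neq0 // mulf_div; split=> //.
by split; rewrite ?mulf_neq0 // mulf_div !tofracM.
Qed.

Lemma rat_valueN z a b c : rat_value z a b c -> rat_value (- z) a b (- c).
Proof.
move=> [n [d [[d0 ->] dab ->]]]; exists (- n), d; rewrite eval2N mulNr; split=> //.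
by split=> //; rewrite tofracN mulNr.
Qed.

Lemma rat_valueD z w a b c c' : rat_value z a b c -> rat_value w a b c' ->
  rat_value (z + w) a b (c + c').
Proof.
move=> [n [d [[d0 ->] dab ->]]] [n' [d' [[d'0 ->] d'ab ->]]].
exists (n * d' + n' * d), (d * d'); rewrite eval2D !eval2M.
split; [split; first exact: mulf_neq0|exact: mulf_neq0|by rewrite addf_div].
by rewrite addf_div ?tofrac_eq0 // -!tofracM -tofracD.
Qed.

Lemma rat_value_inv f a b : eval2 f a b != 0 ->
  rat_value (tofrac f)^-1 a b (eval2 f a b)^-1.
Proof.
move=> fab; exists 1, f; split=> //; last by rewrite eval2_1 div1r.
split; last by rewrite tofrac1 div1r.
by apply: contraNneq fab => ->; rewrite eval2_0.
Qed.

Lemma rat_value_sum (I : Type) (s : seq I) (z : I -> birat F) a b (c : I -> F) :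
  (forall i, rat_value (z i) a b (c i)) ->
  rat_value (\sum_(i <- s) z i) a b (\sum_(i <- s) c i).
Proof.
move=> zc; elim/big_ind2: _ => // [|x x' y y']; last exact: rat_valueD.
by have := rat_value_tofrac 0 a b; rewrite tofrac0 eval2_0.
Qed.

Lemma is_frac_fscale i j z n d : is_frac z n d ->
  is_frac (fscale q_neq0 i j z) (qscale q i j n) (qscale q i j d).
Proof.
by move=> [d0 ->]; split; rewrite ?qscale_eq0 // fmorph_div !fscale_tofrac.
Qed.

Lemma rat_value_fscale i j z a b c : rat_value z (q ^ i * a) (q ^ j * b) c ->
  rat_value (fscale q_neq0 i j z) a b c.
Proof.
move=> [n [d [zf dab ->]]]; exists (qscale q i j n), (qscale q i j d).
by rewrite !eval2_qscale; split=> //; apply: is_frac_fscale.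
Qed.

Lemma rat_value_mul_eval z a b c n d : rat_value z a b c -> is_frac z n d ->
  eval2 d a b * c = eval2 n a b.
Proof. by move=> /(rat_value_cleared 1) h /h; rewrite !mulr1. Qed.

(** Multiplication by [f] absorbs the grid points where no common value is known, and [grid0]
    concludes. *)
Lemma rat_eq f z w : f != 0 ->
  (forall n k, grid f n k != 0 -> exists c,
     rat_value z (q ^+ n) (q ^+ k) c /\ rat_value w (q ^+ n) (q ^+ k) c) ->
  z = w.
Proof.
move=> f0 zw; have [n1 [d1 [d10 e1]]] := fracP z; have [n2 [d2 [d20 e2]]] := fracP w.
suff /eqP : (n1 * d2 - n2 * d1) * f = 0.
  rewrite mulf_eq0 (negPf f0) orbF subr_eq0 => /eqP e.
  by apply/eqP; rewrite e1 e2 GRing.eqr_div ?tofrac_eq0 // -!tofracM e.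
apply: grid0 => n k; rewrite /grid eval2M eval2D eval2N !eval2M -[eval2 f _ _]/(grid f n k).
have [->|fnk] := eqVneq (grid f n k) 0; first by rewrite mulr0.
have [c [zc wc]] := zw n k fnk.
have <- := rat_value_mul_eval zc (conj d10 e1).
have <- := rat_value_mul_eval wc (conj d20 e2).
by rewrite mulrAC (mulrAC _ c) (mulrC (eval2 d1 _ _)) subrr mul0r.
Qed.

Notation sgq := (fscale q_neq0).

Section Term.
Variables (T : nat -> nat -> F) (R1 R2 : birat F).
Hypothesis T_hyper : qhyper_conv q T R1 R2.
Hypothesis T_ex : exists n k : nat, T n k != 0.

Lemma T_neq0 n k : T n k != 0.
Proof.
have step1 m l : (T m.+1 l != 0) = (T m l != 0).
  by have [[c [_ c0 ->]] _] := T_hyper m l; rewrite mulf_eq0 (negPf c0).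
have step2 m l : (T m l.+1 != 0) = (T m l != 0).
  by have [_ [c [_ c0 ->]]] := T_hyper m l; rewrite mulf_eq0 (negPf c0).
have base m l : (T m l != 0) = (T 0%N 0%N != 0).
  by elim: l => [|l IHl]; [elim: m => // m IHm; rewrite step1|rewrite step2].
by have [m [l]] := T_ex; rewrite !base.
Qed.

Lemma R1_value n k : rat_value R1 (q ^+ n) (q ^+ k) (T n.+1 k / T n k).
Proof. by have [[c [h _ ->]] _] := T_hyper n k; rewrite mulfK ?T_neq0. Qed.

Lemma R2_value n k : rat_value R2 (q ^+ n) (q ^+ k) (T n k.+1 / T n k).
Proof. by have [_ [c [h _ ->]]] := T_hyper n k; rewrite mulfK ?T_neq0. Qed.

Lemma certificate_neq0 z c : c != 0 -> rat_value z 1 1 c -> z != 0.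
Proof.
move=> c0 [n [d [[d0 ->] dab ec]]]; rewrite mulf_neq0 ?invr_eq0 ?tofrac_eq0 //.
by apply: contraNneq c0 => n0; rewrite ec n0 eval2_0 mul0r.
Qed.

Lemma R1_neq0 : R1 != 0.
Proof. by apply: certificate_neq0 (R1_value 0 0); rewrite mulf_neq0 ?invr_eq0 ?T_neq0. Qed.

Lemma R2_neq0 : R2 != 0.
Proof. by apply: certificate_neq0 (R2_value 0 0); rewrite mulf_neq0 ?invr_eq0 ?T_neq0. Qed.

Lemma rat_value_shift (i j : nat) z n k c :
  rat_value z (q ^+ (i + n)) (q ^+ (j + k)) c ->
  rat_value (sgq i j z) (q ^+ n) (q ^+ k) c.
Proof. by move=> h; apply: rat_value_fscale; rewrite -!exprnP -!exprD. Qed.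

Lemma certificate_comm : sgq 0 1 R1 * R2 = sgq 1 0 R2 * R1.
Proof.
apply: (@rat_eq 1) => [|n k _]; first exact: oner_neq0.
exists (T n.+1 k.+1 / T n k); split.
  have -> : T n.+1 k.+1 / T n k = T n.+1 k.+1 / T n k.+1 * (T n k.+1 / T n k).
    by rewrite mulrA mulfVK ?T_neq0.
  by apply: rat_valueM (R2_value n k); apply: (rat_value_shift (i := 0) (j := 1)); apply: R1_value.
have -> : T n.+1 k.+1 / T n k = T n.+1 k.+1 / T n.+1 k * (T n.+1 k / T n k).
  by rewrite mulrA mulfVK ?T_neq0.
by apply: rat_valueM (R1_value n k); apply: (rat_value_shift (i := 1) (j := 0)); apply: R2_value.
Qed.

Lemma shift_prod_value m n k :
  rat_value (shift_prod sgq R1 m) (q ^+ n) (q ^+ k) (T (n + m)%N k / T n k).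
Proof.
elim: m => [|m IHm].
  rewrite /shift_prod big_ord0 addn0 divff ?T_neq0 //.
  by have := rat_value_tofrac 1 (q ^+ n) (q ^+ k); rewrite tofrac1 eval2_1.
have -> : T (n + m.+1)%N k / T n k = T (n + m)%N k / T n k * (T (n + m).+1 k / T (n + m)%N k).
  by rewrite addnS [RHS]mulrC mulrA mulfVK ?T_neq0.
rewrite shift_prodS; apply: rat_valueM => //.
by apply: (rat_value_shift (j := 0)); rewrite addnC; apply: R1_value.
Qed.

Lemma operator_value I (a : 'I_I.+1 -> {poly F}) n k :
  rat_value (\sum_(i < I.+1) tofrac (a i)%:P * shift_prod sgq R1 i)
    (q ^+ n) (q ^+ k) (apply_op q a T n k / T n k).
Proof.
rewrite /apply_op mulr_suml; apply: rat_value_sum => i; rewrite -mulrA.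
apply: rat_valueM (shift_prod_value i n k).
by have := rat_value_tofrac (a i)%:P (q ^+ n) (q ^+ k); rewrite /eval2 hornerC.
Qed.

(** With [S2 = p / d] the relation for [G] reads [(p - d) G = d (L T)] on the grid. If [p != d],
    this exhibits [G / T] as a rational function; if [p = d], it forces [L T] to vanish wherever [d]
    does not, and [g = 0] serves. *)
Lemma certificate_of_qZ_pair I (a : 'I_I.+1 -> {poly F}) G :
  qhyper q G -> (forall n k, apply_op q a T n k = G n k.+1 - G n k) ->
  exists g : birat F,
    \sum_(i < I.+1) tofrac (a i)%:P * shift_prod sgq R1 i = R2 * sgq 0 1 g - g.
Proof.
move=> [S1 [S2 [_ _ Gh]]] eG.
pose A := \sum_(i < I.+1) tofrac (a i)%:P * shift_prod sgq R1 i.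
have [p [d [d0 eS2]]] := fracP S2.
have Gpd n k : grid d n k * G n k.+1 = grid p n k * G n k.
  by have [_ /(_ p d (conj d0 eS2))] := Gh n k.
have Gd n k : grid (p - d) n k * G n k = grid d n k * apply_op q a T n k.
  by rewrite eG /grid eval2D eval2N -!/(grid _ _ _) mulrBl mulrBr Gpd.
have [epd|npd] := eqVneq (p - d) 0.
  exists 0; rewrite rmorph0 mulr0 subr0.
  apply: (@rat_eq d) => // n k dnk; exists (apply_op q a T n k / T n k).
  split; first exact: operator_value.
  have /eqP := Gd n k; rewrite epd {1}/grid eval2_0 mul0r eq_sym mulf_eq0 (negPf dnk) /=.
  move=> /eqP->; rewrite mul0r.
  by have := rat_value_tofrac 0 (q ^+ n) (q ^+ k); rewrite tofrac0 eval2_0.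
pose g := A * (tofrac d / tofrac (p - d)); exists g.
have gval n k : grid (p - d) n k != 0 -> rat_value g (q ^+ n) (q ^+ k) (G n k / T n k).
  move=> nz; have -> : G n k / T n k =
      apply_op q a T n k / T n k * (grid d n k / grid (p - d) n k).
    apply: (mulIf nz); rewrite mulrA mulfVK // mulrAC (mulrC (G n k)) Gd; ring.
  apply: rat_valueM; first exact: operator_value.
  by apply: rat_valueM; [apply: rat_value_tofrac|apply: rat_value_inv].
apply: (@rat_eq ((p - d) * qscale q 0 1 (p - d))) => [|n k].
  by rewrite mulf_neq0 ?qscale_eq0.
rewrite /grid eval2M mulf_eq0 negb_or eval2_qscale => /andP[nz1 nz2].
exists (apply_op q a T n k / T n k); split; first exact: operator_value.
have -> : apply_op q a T n k / T n k =
    T n k.+1 / T n k * (G n k.+1 / T n k.+1) - G n k / T n k.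
  by rewrite eG mulrBl; congr (_ - _); rewrite [RHS]mulrC mulrA mulfVK ?T_neq0.
apply: rat_valueD; last by apply/rat_valueN/gval.
apply: rat_valueM (R2_value n k) _.
apply: (rat_value_shift (i := 0) (j := 1)); apply: gval.
by move: nz2; rewrite mul1r -exprS.
Qed.

End Term.
End Grid.

(** * From a rational certificate to a term *)

Section Specialise.
Variables (F : fieldType) (q : F).
Hypothesis q_neq0 : q != 0.
Hypothesis q_not_root1 : forall n : nat, (0 < n)%N -> q ^+ n != 1.
Implicit Types (p d f g : bipoly F).

Definition spec (n : nat) f : {poly F} := map_poly (horner_eval (q ^+ n)) f.

Lemma horner_spec n f k : (spec n f).[q ^+ k] = grid q f n k.
Proof.
have := horner_map (horner_eval (q ^+ n)) f (q ^+ k)%:P.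
by rewrite /= [horner_eval _ (q ^+ k)%:P]hornerC.
Qed.

Lemma specM n f g : spec n (f * g) = spec n f * spec n g.
Proof. by rewrite /spec rmorphM. Qed.

Lemma specB n f g : spec n (f - g) = spec n f - spec n g.
Proof. by rewrite /spec rmorphB. Qed.

Lemma spec_sy n f : spec n (qscale q 0 1 f) = spec n f \Po (q *: 'X).
Proof.
apply/polyP => m; rewrite coef_comp_scale !coef_map coef_qscale01 /=.
by rewrite /horner_eval hornerM -rmorphXn hornerC.
Qed.

Lemma spec_sx n f : spec n (qscale q 1 0 f) = spec n.+1 f.
Proof.
apply/polyP => m; rewrite !coef_map /= /horner_eval.
have -> : (qscale q 1 0 f)`_m = f`_m \Po (q *: 'X).
  by apply/polyP => k; rewrite coef_qscale expr1n mul1r expr1z coef_comp_scale.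
by rewrite horner_comp hornerZ hornerX exprS.
Qed.

(** A nonzero polynomial has finitely many roots and the powers of [q] are distinct. *)
Lemma eventually_neq0 (p : {poly F}) : p != 0 ->
  exists m, forall n, (m <= n)%N -> p.[q ^+ n] != 0.
Proof.
have [N] := ubnP (size p); elim: N p => // N IHN p le_N p0.
have [[n0 r0]|nex] := classic (exists n, root p (q ^+ n)); last first.
  by exists 0%N => n _; apply/negP => r0; apply: nex; exists n.
have [p' ep] := factor_theorem _ _ r0.
have p'0 : p' != 0 by apply: contraNneq p0 => z; rewrite ep z mul0r.
have [|m Hm] := IHN p' _ p'0.
  by move: le_N; rewrite ep size_Mmonic ?monicXsubC // size_XsubC addn2.
exists (maxn m n0.+1) => n; rewrite geq_max => /andP[le_m lt_n].
rewrite ep hornerM hornerXsubC mulf_neq0 ?Hm // subr_eq0.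
by rewrite (inj_eq (expq_inj q_neq0 q_not_root1)) neq_ltn lt_n orbT.
Qed.

(** This and the next three identities clear denominators and cancel common factors, stated for
    abstract elements so that they apply before and after specialising x. *)
Lemma cross_telescope (K : fieldType) (pA dA p2 d2 b V sb sV : K) :
  dA != 0 -> d2 != 0 -> V != 0 -> sV != 0 ->
  pA / dA = p2 / d2 * (sb / sV) - b / V ->
  pA * d2 * sV * V = dA * (p2 * sb * V - d2 * b * sV).
Proof.
move=> dA0 d20 V0 sV0 e.
have -> : pA = dA * (p2 / d2 * (sb / sV) - b / V) by rewrite -e mulrC mulfVK.
by field; rewrite d20 V0 sV0.
Qed.

Lemma cross_ratio (K : fieldType) (p d p1 d1 b V sb sV : K) :
  d != 0 -> d1 != 0 -> V != 0 -> sV != 0 -> b != 0 ->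
  p / d = p1 / d1 * (sb / sV) / (b / V) ->
  p * d1 * sV * b = d * (p1 * sb * V).
Proof.
move=> d0 d10 V0 sV0 b0 e.
have -> : p = d * (p1 / d1 * (sb / sV) / (b / V)) by rewrite -e mulrC mulfVK.
by field; rewrite d10 V0 sV0 b0.
Qed.

Lemma cancel_telescope (K : idomainType) (pA dA p2 d2 b V sb sV h sh : K) :
  h != 0 -> sh != 0 ->
  pA * d2 * (sV * sh) * (V * h) =
    dA * (p2 * (sb * sh) * (V * h) - d2 * (b * h) * (sV * sh)) ->
  pA * d2 * sV * V = dA * (p2 * sb * V - d2 * b * sV).
Proof.
move=> h0 sh0 e; apply: (mulIf (mulf_neq0 h0 sh0)).
by transitivity (pA * d2 * (sV * sh) * (V * h)); [|rewrite e]; ring.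
Qed.

Lemma cancel_ratio (K : idomainType) (p d p1 d1 b V sb sV h sh : K) :
  h != 0 -> sh != 0 ->
  p * d1 * (sV * sh) * (b * h) = d * (p1 * (sb * sh) * (V * h)) ->
  p * d1 * sV * b = d * (p1 * sb * V).
Proof.
move=> h0 sh0 e; apply: (mulIf (mulf_neq0 h0 sh0)).
by transitivity (p * d1 * (sV * sh) * (b * h)); [|rewrite e]; ring.
Qed.

Lemma fmorph_ratio_neq0 (K : fieldType) (s s' : {rmorphism K -> K}) (z g : K) :
  z != 0 -> g != 0 -> s (z * s' g / g) != 0.
Proof. by move=> z0 g0; rewrite fmorph_eq0 !mulf_neq0 ?invr_eq0 ?fmorph_eq0. Qed.

Section Certificate.
Variables (T : nat -> nat -> F) (R1 R2 A : birat F) (L : nat -> nat -> F).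
Hypothesis T_hyper : qhyper_conv q T R1 R2.
Hypothesis T_ex : exists n k : nat, T n k != 0.
Hypothesis A_value : forall n k, rat_value A (q ^+ n) (q ^+ k) (L n k / T n k).
Variables (b V : bipoly F).
Hypotheses (b0 : b != 0) (V0 : V != 0).
Let gg : birat F := tofrac b / tofrac V.
Hypothesis A_eq : A = R2 * fscale q_neq0 0 1 gg - gg.
Variable m : nat.
Hypothesis V_spec : forall n, (m <= n)%N -> (lead_coef V).[q ^+ n] != 0.

(** At x = q^n numerator and denominator of the certificate may acquire a common factor in y;
    dividing it out makes [bn n] and [Vn n] coprime. *)
Let gam n := gcdp (spec n b) (spec n V).
Let bn n := spec n b %/ gam n.
Let Vn n := spec n V %/ gam n.

Lemma spec_neq0 n : (m <= n)%N -> spec n V != 0.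
Proof.
move=> /V_spec; apply: contraNneq => z.
by apply/eqP; have := congr1 (fun p : {poly F} => p`_(size V).-1) z; rewrite coef_map coef0.
Qed.

Lemma gam_neq0 n : (m <= n)%N -> gam n != 0.
Proof. by move=> mn; rewrite gcdp_eq0 negb_and spec_neq0 ?orbT. Qed.

Lemma bnE n : spec n b = bn n * gam n.
Proof. by rewrite divpK ?dvdp_gcdl. Qed.

Lemma VnE n : spec n V = Vn n * gam n.
Proof. by rewrite divpK ?dvdp_gcdr. Qed.

Lemma comp_neq0 (p : {poly F}) : p != 0 -> p \Po (q *: 'X) != 0.
Proof. by rewrite comp_poly2_eq0 // size_scale ?size_polyX. Qed.

Lemma tofrac_neq0 f : f != 0 -> tofrac f != 0.
Proof. by rewrite tofrac_eq0. Qed.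

Lemma tofrac_inj : injective (@FracField.tofrac (bipoly F)).
Proof. by move=> x y /eqP; rewrite tofrac_eq => /eqP. Qed.

(** The gcd is cancelled between polynomials in y, before y is set to q^k, because it may vanish at
    that point. *)
Lemma recurrence n k pA dA p2 d2 : (m <= n)%N -> is_frac A pA dA -> is_frac R2 p2 d2 ->
  grid q pA n k * grid q d2 n k * (Vn n).[q ^+ k.+1] * (Vn n).[q ^+ k] =
  grid q dA n k * (grid q p2 n k * (bn n).[q ^+ k.+1] * (Vn n).[q ^+ k]
                   - grid q d2 n k * (bn n).[q ^+ k] * (Vn n).[q ^+ k.+1]).
Proof.
move=> mn [dA0 eA] [d20 e2].
have e : pA * d2 * qscale q 0 1 V * V =
    dA * (p2 * qscale q 0 1 b * V - d2 * b * qscale q 0 1 V).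
  apply: tofrac_inj; rewrite !(tofracM, tofracB); apply: cross_telescope;
    rewrite ?tofrac_neq0 ?qscale_eq0 //.
  by rewrite -eA -e2 A_eq /gg fmorph_div !fscale_tofrac.
have {e} := congr1 (spec n) e; rewrite !(specM, specB) !spec_sy bnE VnE !comp_polyM => e.
have g0 := gam_neq0 mn; have g0' := comp_neq0 g0.
have {e} := cancel_telescope g0 g0' e.
move/(congr1 (fun p : {poly F} => p.[q ^+ k])).
by rewrite !(hornerM, hornerD, hornerN) !horner_comp !hornerZ !hornerX -!exprS !horner_spec.
Qed.

(** At a zero of [Vn n] the coprime [bn n] does not vanish, so the recurrence makes the next power
    of [q] a zero too, and a nonzero polynomial would have infinitely many roots. *)
Lemma Vn_neq0 n k : (m <= n)%N -> (Vn n).[q ^+ k] != 0.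
Proof.
move=> mn; apply/negP => /eqP V_k.
have step j : (Vn n).[q ^+ j] = 0 -> (Vn n).[q ^+ j.+1] = 0.
  move=> Vj; have [pA [dA [fA dA0 _]]] := A_value n j.
  have [p2 [d2 [f2 d20 _]]] := R2_value T_hyper T_ex n j.
  have := recurrence j mn fA f2; rewrite Vj !mulr0 sub0r => /eqP.
  rewrite eq_sym mulf_eq0 (negPf dA0) oppr_eq0 !mulf_eq0 (negPf d20) /=.
  have cop : coprimep (Vn n) (bn n).
    by rewrite coprimep_sym coprimep_div_gcd // spec_neq0 ?orbT.
  by have := coprimep_root cop (_ : root (Vn n) (q ^+ j)); rewrite /root Vj eqxx => /(_ isT)/negPf-> /= /eqP.
have V_0 : Vn n != 0 by apply: contraNneq (spec_neq0 mn) => z; rewrite VnE z mul0r.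
case/eqP: V_0; apply: (@poly0_of_roots _ (fun j => q ^+ (k + j))).
  by move=> i j /(expq_inj q_neq0 q_not_root1)/addnI.
by elim=> [|j IHj]; rewrite ?addn0 // addnS step.
Qed.

Definition cert_term n k := (bn n).[q ^+ k] / (Vn n).[q ^+ k] * T n k.

Lemma cert_term_telescopes n k : (m <= n)%N ->
  L n k = cert_term n k.+1 - cert_term n k.
Proof.
move=> mn; have [pA [dA [fA dA0 eA]]] := A_value n k.
have [p2 [d2 [f2 d20 e2]]] := R2_value T_hyper T_ex n k.
have T0 := T_neq0 T_hyper T_ex n k; have T1 := T_neq0 T_hyper T_ex n k.+1.
have v0 := Vn_neq0 k mn; have v1 := Vn_neq0 k.+1 mn.
have := recurrence k mn fA f2; rewrite /grid => rec.
have -> : L n k = eval2 pA (q ^+ n) (q ^+ k) / eval2 dA (q ^+ n) (q ^+ k) * T n k.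
  by rewrite -eA mulfVK.
have eT : T n k.+1 = eval2 p2 (q ^+ n) (q ^+ k) / eval2 d2 (q ^+ n) (q ^+ k) * T n k.
  by rewrite -e2 mulfVK.
rewrite /cert_term eT; move: (eval2 pA _ _) (eval2 dA _ _) (eval2 p2 _ _) (eval2 d2 _ _)
  dA0 d20 (bn n).[q ^+ k] (bn n).[q ^+ k.+1] (Vn n).[q ^+ k] (Vn n).[q ^+ k.+1]
  v0 v1 rec (T n k) T0 {eA e2 eT}.
move=> x y z w y0 w0 b1 b2 v1' v2' h1 h2 rec t t0.
apply: (mulIf (_ : y * w * v1' * v2' != 0)); first by rewrite !mulf_neq0.
transitivity (x * w * v2' * v1' * t); first by field.
by rewrite rec; field; rewrite w0 h1.
Qed.

Let R20 := R2_neq0 T_hyper T_ex.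
Let R10 := R1_neq0 T_hyper T_ex.

Lemma gg_neq0 : gg != 0.
Proof. by rewrite mulf_neq0 ?invr_eq0 ?tofrac_neq0. Qed.

(** A cleared relation concerns every fraction representing the certificate, so an arbitrary [p / d]
    is cross-multiplied, specialised and reduced as in [recurrence]. *)
Lemma cert_term_k n k : (m <= n)%N ->
  cleared_rel (R2 * fscale q_neq0 0 1 gg / gg) (q ^+ n) (q ^+ k)
    (cert_term n k) (cert_term n k.+1).
Proof.
move=> mn p d [d0 e]; have [p2 [d2 [[d20 f2] d2n e2]]] := R2_value T_hyper T_ex n k.
have eq : p * d2 * qscale q 0 1 V * b = d * (p2 * qscale q 0 1 b * V).
  apply: tofrac_inj; rewrite !tofracM; apply: cross_ratio;
    rewrite ?tofrac_neq0 ?qscale_eq0 //.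
  by rewrite -e -f2 {1}/gg fmorph_div !fscale_tofrac.
have {eq} := congr1 (spec n) eq; rewrite !specM !spec_sy bnE VnE !comp_polyM => eq.
have g0 := gam_neq0 mn; have g0' := comp_neq0 g0.
have {eq} := cancel_ratio g0 g0' eq.
move/(congr1 (fun p : {poly F} => p.[q ^+ k])).
rewrite !hornerM !horner_comp !hornerZ !hornerX -!exprS !horner_spec /grid => eq.
have T0 := T_neq0 T_hyper T_ex n k.
have v0 := Vn_neq0 k mn; have v1 := Vn_neq0 k.+1 mn.
have eT : T n k.+1 = eval2 p2 (q ^+ n) (q ^+ k) / eval2 d2 (q ^+ n) (q ^+ k) * T n k.
  by rewrite -e2 mulfVK.
rewrite /cert_term eT; move: (eval2 p _ _) (eval2 d _ _) (eval2 p2 _ _) (eval2 d2 _ _)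
  d2n (bn n).[q ^+ k] (bn n).[q ^+ k.+1] (Vn n).[q ^+ k] (Vn n).[q ^+ k.+1]
  v0 v1 eq (T n k) T0 {e2 eT}.
move=> x y z w w0 b1 b2 v1' v2' h1 h2 rec t t0.
apply: (mulIf (_ : w * v1' * v2' != 0)); first by rewrite !mulf_neq0.
transitivity (y * (z * b2 * v1') * t); first by field; rewrite w0 h2.
by rewrite -rec; field.
Qed.

Lemma cert_term_n n k : (m <= n)%N ->
  cleared_rel (R1 * fscale q_neq0 1 0 gg / gg) (q ^+ n) (q ^+ k)
    (cert_term n k) (cert_term n.+1 k).
Proof.
move=> mn p d [d0 e]; have [p2 [d2 [[d20 f2] d2n e2]]] := R1_value T_hyper T_ex n k.
have eq : p * d2 * qscale q 1 0 V * b = d * (p2 * qscale q 1 0 b * V).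
  apply: tofrac_inj; rewrite !tofracM; apply: cross_ratio;
    rewrite ?tofrac_neq0 ?qscale_eq0 //.
  by rewrite -e -f2 {1}/gg fmorph_div !fscale_tofrac.
have {eq} := congr1 (spec n) eq; rewrite !specM !spec_sx !bnE !VnE => eq.
have g0 := gam_neq0 mn; have g0' := gam_neq0 (leqW mn).
have {eq} := cancel_ratio g0 g0' eq.
move/(congr1 (fun p : {poly F} => p.[q ^+ k])).
rewrite !hornerM !horner_spec /grid => eq.
have T0 := T_neq0 T_hyper T_ex n k.
have v0 := Vn_neq0 k mn; have v1 := Vn_neq0 k (leqW mn).
have eT : T n.+1 k = eval2 p2 (q ^+ n) (q ^+ k) / eval2 d2 (q ^+ n) (q ^+ k) * T n k.
  by rewrite -e2 mulfVK.
rewrite /cert_term eT; move: (eval2 p _ _) (eval2 d _ _) (eval2 p2 _ _) (eval2 d2 _ _)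
  d2n (bn n).[q ^+ k] (bn n.+1).[q ^+ k] (Vn n).[q ^+ k] (Vn n.+1).[q ^+ k]
  v0 v1 eq (T n k) T0 {e2 eT}.
move=> x y z w w0 b1 b2 v1' v2' h1 h2 rec t t0.
apply: (mulIf (_ : w * v1' * v2' != 0)); first by rewrite !mulf_neq0.
transitivity (y * (z * b2 * v1') * t); first by field; rewrite w0 h2.
by rewrite -rec; field.
Qed.

Lemma cleared_rel_shift z n k s t : cleared_rel z (q ^+ (m + n)) (q ^+ k) s t ->
  cleared_rel (fscale q_neq0 m 0 z) (q ^+ n) (q ^+ k) s t.
Proof.
move=> h p d [d0 e].
have fr : is_frac z (qscale q (- m%:Z) 0 p) (qscale q (- m%:Z) 0 d).
  split; first by rewrite qscale_eq0.
  transitivity (fscale q_neq0 (- m%:Z) 0 (fscale q_neq0 m 0 z)); last first.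
    by rewrite e fmorph_div !fscale_tofrac.
  have [x [y [y0 ez]]] := fracP z.
  have -> : fscale q_neq0 m 0 z = tofrac (qscale q m 0 x) / tofrac (qscale q m 0 y).
    by rewrite ez fmorph_div !fscale_tofrac.
  by rewrite fmorph_div !fscale_tofrac !qscaleD // addNr addr0 !qscale00.
have := h _ _ fr; rewrite !eval2_qscale expr0z mul1r -exprnN exprD mulKf //.
exact: expf_neq0.
Qed.

(** The term starts at index [m], so both certificates are scaled by q^m in x. *)
Lemma cert_term_qhyper : qhyper q (fun n k => cert_term (m + n) k).
Proof.
pose sc := fscale q_neq0.
exists (sc m 0 (R1 * sc 1 0 gg / gg)), (sc m 0 (R2 * sc 0 1 gg / gg)); split=> [||n k].
- exact (@fmorph_ratio_neq0 _ (sc m 0) (sc 1 0) R1 gg R10 gg_neq0).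
- exact (@fmorph_ratio_neq0 _ (sc m 0) (sc 0 1) R2 gg R20 gg_neq0).
split.
  rewrite addnS; exact (cleared_rel_shift (cert_term_n k (leq_addr n m))).
exact (cleared_rel_shift (cert_term_k k (leq_addr n m))).
Qed.

End Certificate.
End Specialise.

(** * Translation to F[x, y] and the two implications for terms *)

Section Assembly.
Variables (F : fieldType) (q : F).
Hypothesis q_neq0 : q != 0.
Hypothesis q_not_root1 : forall n : nat, (0 < n)%N -> q ^+ n != 1.
Implicit Types (P p f g r s u v : bipoly F).

Let Sq (i j : int) : {rmorphism bipoly F -> bipoly F} := qscale q i j.

Lemma over_Fx_dvd P f : P %| f -> over_Fx P %| over_Fx f.
Proof.
move=> /pdvdP[c [g [c0 e]]].
have := congr1 (map_poly (@FracField.tofrac {poly F})) e.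
rewrite -mul_polyC !rmorphM /= map_polyC /= mul_polyC => e'.
by apply/pdvdP; exists (tofrac c), (over_Fx g); rewrite tofrac_eq0.
Qed.

Lemma size_over_Fx f : size (over_Fx f) = size f.
Proof.
apply: size_map_inj_poly; last by rewrite tofrac0.
by move=> x y /eqP; rewrite tofrac_eq => /eqP.
Qed.

Lemma over_Fx_coprime P f g : irreducible_poly P ->
  coprimep (over_Fx f) (over_Fx g) -> P %| f -> ~~ (P %| g).
Proof.
move=> irP cop /over_Fx_dvd Pf; apply/negP => /over_Fx_dvd Pg.
have : over_Fx P %| gcdp (over_Fx f) (over_Fx g) by rewrite dvdp_gcd Pf Pg.
move/dvdp_leq; rewrite -size_poly_gt0 (coprimep_size_gcd cop) size_over_Fx => /(_ isT).
by rewrite leqNgt (irr_size irP).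
Qed.

Lemma over_Fx_neq0 f : ~~ ('X %| over_Fx f) -> f != 0.
Proof. by apply: contraNneq => ->; rewrite /over_Fx map_poly0 dvdp0. Qed.

(** The primitive part of [P] is irreducible in F[x, y], so eps-freeness applies to it; the
    exceptional factor y is excluded because y does not divide [v]. *)
Lemma eps_free_row v : ~~ ('X %| over_Fx v) -> eps_free q v ->
  forall P m, irreducible_poly P -> P %| v -> P %| Sq 0 m v -> m = 0.
Proof.
move=> nX eps P m irP Pv PSv; apply/eqP; apply: contraT => m0.
have [p [irp prp Pp pP]] := irr_primitive_part irP.
have sp : (1 < size p)%N.
  by apply: leq_trans (irr_size irP) (dvdp_leq _ Pp); case: irp.
have [||c _ ep] := eps m m0 p irp sp.
- exact: primitive_dvd2 prp (dvdp_trans pP Pv).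
- exact: primitive_dvd2 prp (dvdp_trans pP PSv).
case/negP: nX; have Xp : 'X %| p by rewrite ep dvdp_mulIr.
have Xv := dvdp_trans Xp (dvdp_trans pP Pv).
by have := over_Fx_dvd Xv; rewrite /over_Fx map_polyX.
Qed.

Lemma dvd2_dvdp p f : dvd2 p f -> p %| f.
Proof. by move=> [g ->]; apply: dvdp_mulIr. Qed.

Lemma q_proper_nonfree v P : q_proper q v -> irreducible_poly P -> P %| v ->
  ~ free Sq P.
Proof.
move=> [_ vP] irP Pv fP; have [p [irp prp Pp pP]] := irr_primitive_part irP.
have [i [j [ij /dvd2_dvdp pS]]] := vP p irp (primitive_dvd2 prp (dvdp_trans pP Pv)).
have SpP : qscale q i j p %| qscale q i j P.
  exact: (@dvd_S_imp _ Sq (@size_qscale _ _ q_neq0) i j p P pP).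
have [i0 j0] := fP i j (dvdp_trans Pp (dvdp_trans pS SpP)).
by move: ij; rewrite i0 j0 eqxx.
Qed.

Lemma nonfree_q_proper v : v != 0 ->
  (forall P, irreducible_poly P -> free Sq P -> ~~ (P %| v)) -> q_proper q v.
Proof.
move=> v0 nf; split=> // p irp pv.
(* A factor lying in F[x] is fixed by every scaling of y, so the pair (0, 1) serves. *)
have [sp|sp] := leqP (size p) 1.
  exists 0, 1; split=> //; rewrite (size1_polyC sp) qscale0C.
  by exists 1; rewrite mul1r.
have [prp irp'] := irreducible2_irr irp sp.
apply: NNPP => nex; have /negP[] : ~~ (p %| v); last exact: dvd2_dvdp.
apply: nf => // i j pS; apply: NNPP => ij; apply: nex; exists i, j.
split; last exact: primitive_dvd2.
by apply: contraT; rewrite negb_or !negbK => /andP[/eqP i0 /eqP j0]; case: ij.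
Qed.

(** Drops vanishing top coefficients: the pole argument needs the coefficient of highest order to be
    nonzero. *)
Lemma truncate_sum (R : nzRingType) (E : pzRingType) (psi : R -> E) (B : nat -> E)
    (I : nat) (a : 'I_I.+1 -> R) :
  psi 0 = 0 -> (exists i, a i != 0) ->
  exists (J : nat) (a' : nat -> R), a' J != 0 /\
    \sum_(i < I.+1) psi (a i) * B i = \sum_(i < J.+1) psi (a' i) * B i.
Proof.
move=> psi0 [i0 ai0]; pose a' n := oapp a 0 (insub n).
have a'E (i : 'I_I.+1) : a' i = a i by rewrite /a' valK.
case: (@arg_maxnP _ i0 (fun i => a i != 0) (@nat_of_ord _) ai0) => J aJ maxJ.
exists J, a'; split; first by rewrite a'E.
rewrite (big_ord_widen I.+1 (fun i => psi (a' i) * B i)) // [RHS]big_mkcond.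
apply: eq_bigr => i _; rewrite a'E; case: ltnP => // lt_i.
have /eqP-> : a i == 0 by apply: contraTT lt_i => /maxJ; rewrite -ltnNge ltnS.
by rewrite psi0 mul0r.
Qed.

(** The coefficients of N^m L, obtained from those of L by replacing x with q^m x and raising the
    index by [m]. *)
Lemma apply_op_shift (T : nat -> nat -> F) (I m : nat) (a : 'I_I.+1 -> {poly F}) :
  (exists i, a i != 0) ->
  exists a' : 'I_(I + m).+1 -> {poly F}, (exists i, a' i != 0) /\
    forall n k, apply_op q a' T n k = apply_op q a T (m + n) k.
Proof.
move=> [i0 ai0]; have qm0 : q ^+ m != 0 by apply: expf_neq0.
pose aN n := oapp a 0 (insub n); have aNE (i : 'I_I.+1) : aN i = a i by rewrite /aN valK.
pose b n := if (m <= n)%N then aN (n - m)%N \Po (q ^+ m *: 'X) else 0.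
exists (fun j => b j); split.
  have lt : (i0 + m < (I + m).+1)%N by rewrite ltnS leq_add2r -ltnS.
  exists (Ordinal lt); rewrite /b /= leq_addl addnK aNE.
  by rewrite comp_poly2_eq0 // size_scale ?size_polyX.
move=> n k; rewrite /apply_op.
rewrite -(big_mkord xpredT (fun j => (b j).[q ^+ n] * T (n + j)%N k)).
rewrite (@big_cat_nat _ _ _ m) //=; last by rewrite leqW // leq_addl.
rewrite big_nat_cond big1 ?add0r => [|j /andP[/andP[_ lt_j] _]]; last first.
  by rewrite /b leqNgt lt_j horner0 mul0r.
rewrite -{1}[m]add0n big_addn subSn ?leq_addl // addnK big_mkord.
apply: eq_bigr => i _; rewrite /b leq_addl addnK aNE horner_comp hornerZ hornerX -exprD.
by rewrite addnA [(n + i + m)%N]addnC addnA.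
Qed.

Section Normal.
Variables (T : nat -> nat -> F) (R1 R2 : birat F) (r s u v : bipoly F).
Hypothesis T_hyper : qhyper_conv q T R1 R2.
Hypothesis T_ex : exists n k : nat, T n k != 0.
Hypothesis T_normal : q_normal_rep q R2 r s u v.

Let sc := fscale q_neq0.
Let w : birat F := tofrac u / tofrac v.

Lemma normal_uv_neq0 : u != 0 /\ v != 0.
Proof. by case: T_normal => _ _ _ [hu hv] _; split; apply: over_Fx_neq0. Qed.

Lemma normal_s_neq0 : s != 0.
Proof. by case: T_normal. Qed.

Lemma normal_R2 : R2 = tofrac r / tofrac s * (sc 0 1 w / w).
Proof. by case: T_normal => _ -> _ _ _; rewrite /w fmorph_div !fscale_tofrac. Qed.

Lemma normal_r_neq0 : r != 0.
Proof.
have R20 := R2_neq0 T_hyper T_ex; apply/negP => /eqP r0; case/negP: R20.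
by rewrite normal_R2 r0 tofrac0 !mul0r.
Qed.

Lemma normal_row_coprime : row_coprime Sq r s.
Proof.
case: T_normal => _ _ _ _ cop k P irP; apply: over_Fx_coprime => //.
exact: cop.
Qed.

Lemma normal_comm_certificates :
  sc 0 1 R1 * (tofrac r / tofrac s * (sc 0 1 w / w)) =
  sc 1 0 (tofrac r / tofrac s * (sc 0 1 w / w)) * R1.
Proof. by have := certificate_comm q_neq0 q_not_root1 T_hyper T_ex; rewrite {1 2}normal_R2. Qed.

Lemma qZ_pair_q_proper : eps_free q v -> has_qZ_pair q T -> q_proper q v.
Proof.
move=> eps [I [a [G [a0 Gh eG]]]].
have [u0 v0] := normal_uv_neq0.
have [_ _ cop [_ nXv] _] := T_normal.
have [g eg] := certificate_of_qZ_pair q_neq0 q_not_root1 T_hyper T_ex Gh eG.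
have [|J [a' [aJ es]]] := @truncate_sum _ (birat F) (fun c : {poly F} => tofrac c%:P)
  (shift_prod sc R1) I a _ a0; first by rewrite polyC0 tofrac0.
apply: nonfree_q_proper => // P irP fP.
have uv Q : irreducible_poly Q -> Q %| v -> ~~ (Q %| u).
  by move=> irQ; apply: over_Fx_coprime => //; rewrite coprimep_sym.
have eq := etrans (esym es) eg; rewrite {1}normal_R2 in eq.
exact (@free_ndvd_of_telescoper _ Sq (@qscale00 _ q) (@qscaleD _ _ q_neq0)
  (@size_qscale _ _ q_neq0) _ (@FracField.tofrac (bipoly F)) (@tofrac_eq0 _) (@fracP _) sc
  (fscale_tofrac q_neq0) r s u v R1 normal_r_neq0 normal_s_neq0 u0 v0
  (R1_neq0 T_hyper T_ex) normal_row_coprime normal_comm_certificates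
  g a' J P uv (eps_free_row nXv eps) aJ eq irP fP).
Qed.

Lemma q_proper_qZ_pair : q_proper q v -> has_qZ_pair q T.
Proof.
move=> vprop; have [u0 v0] := normal_uv_neq0.
have qinj : injective (GRing.exp (q%:P : {poly F})).
  by move=> i j; rewrite -!rmorphXn => /polyC_inj/(expq_inj q_neq0 q_not_root1).
have [I [a [g [a0 eg]]]] := @telescoper_of_nonfree _ Sq (@qscale00 _ q) (@qscaleD _ _ q_neq0)
  (@size_qscale _ _ q_neq0) _ (@FracField.tofrac (bipoly F)) (@tofrac_eq0 _) (@fracP _) sc
  (fscale_tofrac q_neq0) (@qscale0C _ q) q%:P (@coef_qscale01 _ q) qinj r s u v R1
  normal_r_neq0 normal_s_neq0 u0 v0
  (R1_neq0 T_hyper T_ex) normal_row_coprime normal_comm_certificates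
  (fun P => @q_proper_nonfree v P vprop).
rewrite -normal_R2 in eg.
have val := operator_value q_neq0 T_hyper T_ex a.
(* If [g = 0], then L annihilates T and [G = 0] works with both certificates equal to 1, which must
   be nonzero. *)
have [g0|g0] := eqVneq g 0.
  exists I, a, (fun _ _ => 0); split=> //.
    by exists 1, 1; split=> [||n k]; rewrite ?oner_eq0 //; split=> p d _; rewrite !mulr0.
  move=> n k; rewrite subrr; have := val n k; rewrite eg g0 rmorph0 mulr0 subr0.
  move=> [p [d [[d0 e] dnk eL]]].
  have p0 : p = 0.
    apply/eqP; rewrite -tofrac_eq0; move/esym/eqP: e.
    by rewrite mulf_eq0 invr_eq0 (tofrac_eq0 d) (negPf d0) orbF.
  have T0 := T_neq0 T_hyper T_ex n k.
  by move/eqP: eL; rewrite p0 eval2_0 mul0r mulf_eq0 invr_eq0 (negPf T0) orbF => /eqP.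
have [b [V [V0 egV]]] := fracP g.
have b0 : b != 0 by apply/negP => /eqP b0; case/negP: g0; rewrite egV b0 tofrac0 mul0r.
have lV0 : lead_coef V != 0 by rewrite lead_coef_eq0.
(* From [m] on, the leading coefficient of [V] does not vanish at q^n, so the specialised
   denominator is nonzero; N^m L replaces L for this reason. *)
have [m Hm] := eventually_neq0 q_neq0 q_not_root1 lV0.
rewrite egV in eg.
have [a' [a'0 ea']] := apply_op_shift T m a0.
exists (I + m)%N, a', (fun n k => cert_term q T b V (m + n) k); split=> //.
  exact (cert_term_qhyper q_not_root1 T_hyper T_ex val b0 V0 eg Hm).
move=> n k; rewrite ea'.
exact (cert_term_telescopes q_not_root1 T_hyper T_ex val V0 eg Hm k (leq_addr n m)).
Qed.

End Normal.
End Assembly.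

Theorem theorem4p4 (F : fieldType) (q : F)
    (charF0 : [pchar F] =i pred0)
    (q_neq0 : q != 0)
    (q_not_root1 : forall n : nat, (0 < n)%N -> q ^+ n != 1)
    (T : nat -> nat -> F) (R1 R2 : birat F)
    (T_hyper : qhyper_conv q T R1 R2)
    (T_neq0 : exists n k : nat, T n k != 0)
    (r s u v : bipoly F)
    (T_normal : q_normal_rep q R2 r s u v)
    (v_free : eps_free q v) :
  has_qZ_pair q T <-> q_proper q v.
Proof.
split.
  exact (qZ_pair_q_proper q_neq0 q_not_root1 T_hyper T_neq0 T_normal v_free).
exact (q_proper_qZ_pair q_neq0 q_not_root1 T_hyper T_neq0 T_normal).
Qed.
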